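(* Let $K$ be an infinite field of any characteristic and let $I$ be a graded ideal of the polynomial ring $R=K[x_1,\ldots,x_n]$ (with the standard grading). Then $I$ is a completely $\mathfrak m$-full ideal if and only if it is a componentwise linear ideal.
   Context: $\mathfrak m=(x_1,\ldots,x_n)$ is the graded maximal ideal. For an ideal $J$ and an element $z$, $J:z=\{f\in R\mid zf\in J\}$. A property holds ''for a general linear form $z$'' if it holds for all $z$ in some nonempty Zariski open subset of the $K$-vector space $R_1$ of linear forms. Completely $\mathfrak m$-full ideals are defined recursively on the number $n$ of variables. (1) If $n=0$ (i.e. if $R$ is a field), then the zero ideal is completely $\mathfrak m$-full. (2) If $n>0$, then a graded ideal $I$ of $R$ is completely $\mathfrak m$-full if $\mathfrak m I:z=I$ and $(I+zR)/zR$ is completely $\mathfrak m$-full as an ideal of $R/zR$ (a polynomial ring in $n-1$ variables over $K$), where $z$ is a general linear form in $R$. For a graded ideal $I$, $I_{<j>}$ denotes the ideal generated by all homogeneous polynomials of degree $j$ belonging to $I$. The graded ideal $I$ is componentwise linear if $I_{<j>}$ has a linear resolution for all $j$ (i.e. the $i$-th module in the minimal graded free resolution of $I_{<j>}$ is generated in degree $i+j$ for all $i$; the zero ideal is regarded as having a linear resolution).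
   Formalization: The unit ideal I = R is declared completely m-full by convention; under the recursive definition as stated (only the zero ideal of a field as base case) R would not be completely m-full although it is componentwise linear, so the equivalence would fail for that one ideal. *)

(* Defs.v *)
From HB Require Import structures.
From mathcomp Require Import all_boot all_algebra.
From mathcomp Require Export mpoly.

Set Implicit Arguments.
Unset Strict Implicit.
Unset Printing Implicit Defensive.

Import GRing.Theory.
Local Open Scope ring_scope.

(* Ideals, and more generally subsets, of a polynomial ring are Prop-valued
   predicates. *)
Section Ideals.
Variables (K : fieldType) (n : nat).
Local Notation R := {mpoly K[n]}.
Implicit Types (I J S : R -> Prop) (f z : R).

Definition is_ideal I : Prop :=
  [/\ I 0, forall f g, I f -> I g -> I (f + g) & forall f g, I g -> I (f * g)].

Definition is_graded_ideal I : Prop :=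
  is_ideal I /\ forall f d, I f -> I (pihomog mdeg d f).

Definition ideal_eq I J : Prop := forall f, I f <-> J f.

Definition ideal_gen S : R -> Prop := fun f =>
  exists (k : nat) (c g : 'I_k -> R),
    (forall i, S (g i)) /\ f = \sum_(i < k) c i * g i.

Definition ideal_add I J : R -> Prop := fun f =>
  exists g h, [/\ I g, J h & f = g + h].

Definition ideal_mul I J : R -> Prop :=
  ideal_gen (fun f => exists g h, [/\ I g, J h & f = g * h]).

Definition principal_ideal z : R -> Prop := ideal_gen (fun f => f = z).

Definition ideal_colon I z : R -> Prop := fun f => I (z * f).

Definition maximal_ideal : R -> Prop :=
  ideal_gen (fun f => exists i : 'I_n, f = 'X_i).

Definition ideal_degree_part I (j : nat) : R -> Prop :=
  ideal_gen (fun f => I f /\ f \is j.-homog).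

End Ideals.

Section GeneralLinearForms.
Variables (K : fieldType) (n : nat).

Definition zariski_open (U : ('I_n -> K) -> Prop) : Prop :=
  exists S : {mpoly K[n]} -> Prop,
    forall a, U a <-> exists2 p, S p & p.@[a] != 0.

Definition linear_form (a : 'I_n -> K) : {mpoly K[n]} :=
  \sum_(i < n) a i *: 'X_i.

(* The space of linear forms is identified with K^n through the
   coefficients. *)
Definition for_general_linear_form (P : {mpoly K[n]} -> Prop) : Prop :=
  exists U : ('I_n -> K) -> Prop,
    [/\ zariski_open U, exists a, U a & forall a, U a -> P (linear_form a)].

End GeneralLinearForms.

(* [phi] induces an isomorphism of graded K-algebras from R/zR onto the
   polynomial ring in one variable less.  There is no such [phi] for z = 0. *)
Definition is_quotient_by (K : fieldType) (n : nat) (z : {mpoly K[n.+1]})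
    (phi : {lrmorphism {mpoly K[n.+1]} -> {mpoly K[n]}}) : Prop :=
  [/\ forall i, phi 'X_i \is 1.-homog,
      forall g, exists f, phi f = g
    & forall f, phi f = 0 <-> principal_ideal z f].

Definition ideal_image (K : fieldType) (m n : nat)
    (phi : {mpoly K[m]} -> {mpoly K[n]}) (I : {mpoly K[m]} -> Prop) :
    {mpoly K[n]} -> Prop :=
  fun g => exists2 f, I f & phi f = g.

(* The identification of R/zR with a polynomial ring is unique up to a linear
   change of coordinates, under which the notion is invariant; hence it is
   harmless to ask for one such identification. *)
Fixpoint completely_m_full_rec (K : fieldType) (n : nat) :
    ({mpoly K[n]} -> Prop) -> Prop :=
  match n return ({mpoly K[n]} -> Prop) -> Prop with
  | 0 => fun I => forall f, I f <-> f = 0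
  | n'.+1 => fun I =>
      for_general_linear_form (fun z =>
        ideal_eq (ideal_colon (ideal_mul (@maximal_ideal K n'.+1) I) z) I /\
        exists phi : {lrmorphism {mpoly K[n'.+1]} -> {mpoly K[n']}},
          is_quotient_by z phi /\
          completely_m_full_rec
            (ideal_image phi (ideal_add I (principal_ideal z))))
  end.

(* The recursion starts from the zero ideal of a field, so it only reaches
   proper ideals; the unit ideal, for which m R : z = R trivially holds, is
   completely m-full by convention. *)
Definition completely_m_full (K : fieldType) (n : nat)
    (I : {mpoly K[n]} -> Prop) : Prop :=
  I 1 \/ completely_m_full_rec I.

Section Resolutions.
Variables (K : fieldType) (n : nat).
Local Notation R := {mpoly K[n]}.
Implicit Types (I J : R -> Prop).

(* Graded free resolution  ... -> F_1 -> F_0 -> J -> 0  of a graded ideal J,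
   where F_i is free with basis elements indexed by k < rk i, the k-th one of
   degree bdeg i k.  Elements of F_i are row vectors and maps act by right
   multiplication; the homogeneity conditions say that the maps preserve
   degrees. *)
Record graded_free_resolution J := GradedFreeResolution {
  rk : nat -> nat;
  bdeg : forall i, 'I_(rk i) -> nat;
  aug : 'cV[R]_(rk 0);
  diff : forall i, 'M[R]_(rk i.+1, rk i);
  aug_homog : forall k, aug k 0 \is (bdeg k).-homog;
  diff_homog : forall i k l, diff i k l = 0 \/
    exists2 e, (e + bdeg l)%N = bdeg k & diff i k l \is e.-homog;
  aug_image : forall f, J f <-> exists v : 'rV[R]_(rk 0), (v *m aug) 0 0 = f;
  aug_exact : forall v : 'rV[R]_(rk 0),
    v *m aug = 0 <-> exists w : 'rV[R]_(rk 1), w *m diff 0 = v;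
  diff_exact : forall i (v : 'rV[R]_(rk i.+1)),
    v *m diff i = 0 <-> exists w : 'rV[R]_(rk i.+2), w *m diff i.+1 = v
}.

Definition minimal_resolution J (F : graded_free_resolution J) : Prop :=
  forall i k l, @maximal_ideal K n (diff F i k l).

(* The minimal graded free resolution is unique up to isomorphism, and so are
   the degrees of its generators. *)
Definition has_linear_resolution J (j : nat) : Prop :=
  exists F : graded_free_resolution J,
    minimal_resolution F /\
    forall i (k : 'I_(rk F i)), bdeg k = (i + j)%N.

Definition componentwise_linear I : Prop :=
  forall j, has_linear_resolution (ideal_degree_part I j) j.

End Resolutions.

Definition infinite_field (K : fieldType) : Prop :=
  forall s : seq K, exists x, x \notin s.

(* Main.v *)
(* An ideal J generated in degree d has a linear resolution iff, for a general
   linear form z, the image of J in R/zR has one and every form f of degree d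
   with z f in J lies in J. Since a form f of degree d satisfies z f in m I iff
   z f lies in I_<d>, the condition m I : z = I says exactly this colon condition
   for all J = I_<d>, and both notions unfold along the same recursion.

   Linear resolutions are handled coinductively, through submodules of free
   modules: N is linear when it has a generator matrix A with homogeneous
   entries of the same degree whose syzygy module rker A is again linear, with
   generators of degree 1. As R^p / rker A is z-torsion free, linearity of rker A
   is equivalent to linearity of its image modulo z; when the colon condition
   holds, this image is the direct sum of the syzygies of the image of N and of
   copies of the maximal ideal of R/zR.

   For a given linear J, the colon condition for general z follows from two facts:
   R/J has no socle in degree at least d, and, by Noetherian induction, a general
   z is such that z f in J puts f in the saturation of J. By Noetherianity
   finitely many open conditions handle all degrees d. *)
Require Import Defs.
From mathcomp Require Import all_boot all_order all_algebra.
From mathcomp Require Import zify.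
From Stdlib Require Import Classical ClassicalEpsilon.

Set Implicit Arguments.
Unset Strict Implicit.
Unset Printing Implicit Defensive.

Import Order.TTheory GRing.Theory.
Local Open Scope ring_scope.

Local Notation hcomp := (pihomog mdeg).

(** * Homogeneous components and linear resolutions *)

Section Homogeneous.
Variables (K : fieldType) (n : nat).
Local Notation R := {mpoly K[n]}.
Implicit Types (f g : R).

Lemma hcomp_ne d e f : d != e -> f \is d.-homog -> hcomp e f = 0.
Proof. exact: pihomog_ne0. Qed.

Lemma dhomog_eq d e f : d = e -> f \is d.-homog -> f \is e.-homog.
Proof. by move->. Qed.

Lemma hcompM d s f g : g \is s.-homog -> hcomp (d + s) (f * g) = hcomp d f * g.
Proof.
move=> hg; rewrite {1}(@pihomog_partitionE _ _ mdeg (maxn (mmeasure mdeg f) d.+1) f) ?leq_maxl //.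
have lt : (d < maxn (mmeasure mdeg f) d.+1)%N by rewrite leq_maxr.
rewrite mulr_suml linear_sum (bigD1 (Ordinal lt)) //= big1 ?addr0.
  by rewrite pihomog_dE // dhomogM // pihomogP.
move=> i ne; apply: (hcomp_ne (d := (i + s)%N)); last by rewrite dhomogM // pihomogP.
by rewrite eqn_add2r.
Qed.

Lemma hcompM_low d s f g : g \is s.-homog -> (d < s)%N -> hcomp d (f * g) = 0.
Proof.
move=> hg ds; rewrite {1}(@pihomog_partitionE _ _ mdeg (mmeasure mdeg f) f) //.
rewrite mulr_suml linear_sum big1 // => i _.
apply: (hcomp_ne (d := (i + s)%N)); last by rewrite dhomogM // pihomogP.
by rewrite gtn_eqF // ltn_addl.
Qed.

Lemma dhomog0E f : f \is 0.-homog -> f = (f@_0)%:MP.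
Proof.
move=> /dhomogP hf; apply/mpolyP => m; rewrite mcoeffC.
have [->|ne] := eqVneq 0%MM m; first by rewrite mulr1.
rewrite mulr0; apply/eqP; rewrite mcoeff_eq0; apply/negP => /hf /eqP.
by rewrite mdeg_eq0 eq_sym (negPf ne).
Qed.

Lemma dhomogC (c : K) : (c%:MP_[n]) \is 0.-homog.
Proof. by rewrite -[c%:MP]mulr1 mul_mpolyC rpredZ // dhomog1. Qed.

Lemma dhomogXi (i : 'I_n) : ('X_i : R) \is 1.-homog.
Proof. by rewrite dhomogX; apply/eqP; exact: mdeg1. Qed.

End Homogeneous.

Lemma dhomog_nvar0 (K : fieldType) d (f : {mpoly K[0]}) :
  (0 < d)%N -> f \is d.-homog -> f = 0.
Proof.
move=> d0 hf; apply/eqP; case: eqP => // /eqP nz.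
by move: d0; rewrite (dhomog_uniq nz hf (nvar0_homog _ f)).
Qed.

(** * Matrices with homogeneous entries *)

Section HomogeneousMatrices.
Variables (K : fieldType) (n : nat).
Local Notation R := {mpoly K[n]}.

Definition mhomog s p q (A : 'M[R]_(p, q)) := forall i j, A i j \is s.-homog.

Definition mcomp s p q (A : 'M[R]_(p, q)) := map_mx (hcomp s) A.

Lemma mcompP s p q (A : 'M[R]_(p, q)) : mhomog s (mcomp s A).
Proof. by move=> i j; rewrite mxE pihomogP. Qed.

Lemma mcomp_id s p q (A : 'M[R]_(p, q)) : mhomog s A -> mcomp s A = A.
Proof. by move=> hA; apply/matrixP => i j; rewrite mxE pihomog_dE. Qed.

Lemma mcomp0 s p q : @mcomp s p q 0 = 0.
Proof. by apply/matrixP => i j; rewrite !mxE linear0. Qed.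

Lemma mcomp_row_mx s p q1 q2 (A : 'M[R]_(p, q1)) (B : 'M[R]_(p, q2)) :
  mcomp s (row_mx A B) = row_mx (mcomp s A) (mcomp s B).
Proof. exact: map_row_mx. Qed.

Lemma mcompM d s p q r (A : 'M[R]_(p, q)) (B : 'M[R]_(q, r)) :
  mhomog s B -> mcomp (d + s) (A *m B) = mcomp d A *m B.
Proof.
move=> hB; apply/matrixP => i j; rewrite !mxE linear_sum.
by apply: eq_bigr => k _ /=; rewrite hcompM // !mxE.
Qed.

Lemma mcompM_low d s p q r (A : 'M[R]_(p, q)) (B : 'M[R]_(q, r)) :
  mhomog s B -> (d < s)%N -> mcomp d (A *m B) = 0.
Proof.
move=> hB ds; apply/matrixP => i j; rewrite !mxE linear_sum big1 // => k _.
exact: (hcompM_low _ (hB _ _)).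
Qed.

Lemma mcompZ d s p q f (A : 'M[R]_(p, q)) :
  f \is s.-homog -> mcomp (d + s) (f *: A) = f *: mcomp d A.
Proof.
by move=> hf; apply/matrixP => i j; rewrite !mxE mulrC hcompM // mulrC.
Qed.

Lemma mcompZ_low d s p q f (A : 'M[R]_(p, q)) :
  f \is s.-homog -> (d < s)%N -> mcomp d (f *: A) = 0.
Proof.
by move=> hf ds; apply/matrixP => i j; rewrite !mxE mulrC (hcompM_low _ hf).
Qed.

Lemma mhomog0 s p q : mhomog s (0 : 'M[R]_(p, q)).
Proof. by move=> i j; rewrite mxE rpred0. Qed.

Lemma mhomogD s p q (A B : 'M[R]_(p, q)) :
  mhomog s A -> mhomog s B -> mhomog s (A + B).
Proof. by move=> hA hB i j; rewrite mxE rpredD. Qed.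

Lemma mhomogN s p q (A : 'M[R]_(p, q)) : mhomog s A -> mhomog s (- A).
Proof. by move=> hA i j; rewrite mxE rpredN. Qed.

Lemma mhomogB s p q (A B : 'M[R]_(p, q)) :
  mhomog s A -> mhomog s B -> mhomog s (A - B).
Proof. by move=> hA hB; apply/mhomogD/mhomogN. Qed.

Lemma mhomogM d s p q r (A : 'M[R]_(p, q)) (B : 'M[R]_(q, r)) :
  mhomog d A -> mhomog s B -> mhomog (d + s) (A *m B).
Proof.
by move=> hA hB i j; rewrite mxE rpred_sum // => k _; rewrite dhomogM.
Qed.

Lemma mhomogZ d s p q f (A : 'M[R]_(p, q)) :
  f \is d.-homog -> mhomog s A -> mhomog (d + s) (f *: A).
Proof. by move=> hf hA i j; rewrite mxE dhomogM. Qed.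

Lemma mhomog_row_mx s p q1 q2 (A : 'M[R]_(p, q1)) (B : 'M[R]_(p, q2)) :
  mhomog s (row_mx A B) <-> mhomog s A /\ mhomog s B.
Proof.
split=> [h|[hA hB] i j]; last by rewrite mxE; case: split.
by split=> i j; [rewrite -(row_mxEl _ B) | rewrite -(row_mxEr A)].
Qed.

Lemma mhomog_col_mx s p1 p2 q (A : 'M[R]_(p1, q)) (B : 'M[R]_(p2, q)) :
  mhomog s (col_mx A B) <-> mhomog s A /\ mhomog s B.
Proof.
split=> [h|[hA hB] i j]; last by rewrite mxE; case: split.
by split=> i j; [rewrite -(col_mxEu _ B) | rewrite -(col_mxEd A)].
Qed.

Lemma mhomog_row s p q (A : 'M[R]_(p, q)) i : mhomog s A -> mhomog s (row i A).
Proof. by move=> hA a b; rewrite mxE. Qed.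

Lemma mhomogC p q (A : 'M[K]_(p, q)) : mhomog 0 (map_mx (@mpolyC n K) A).
Proof. by move=> i j; rewrite mxE dhomogC. Qed.

Lemma mhomog0E p q (A : 'M[R]_(p, q)) :
  mhomog 0 A -> A = map_mx (@mpolyC n K) (map_mx (mcoeff 0%MM) A).
Proof. by move=> hA; apply/matrixP => i j; rewrite !mxE -dhomog0E. Qed.

Lemma mcomp_partition p q (A : 'M[R]_(p, q)) :
  exists k, A = \sum_(d < k) mcomp d A.
Proof.
pose k := \max_i \max_j mmeasure mdeg (A i j).
exists k; apply/matrixP => i j; rewrite summxE {1}(@pihomog_partitionE _ _ mdeg k (A i j)).
  by apply: eq_bigr => d _; rewrite mxE.
by apply: leq_trans (leq_bigmax i); apply: (leq_bigmax j).
Qed.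

End HomogeneousMatrices.

(** * Graded submodules of free modules and their linear resolutions *)

Section RowModules.
Variables (K : fieldType) (n : nat).
Local Notation R := {mpoly K[n]}.

Definition submod q (N : 'rV[R]_q -> Prop) :=
  [/\ N 0, forall u v, N u -> N v -> N (u + v) & forall c v, N v -> N (c *: v)].

Definition graded_submod q (N : 'rV[R]_q -> Prop) :=
  submod N /\ forall v d, N v -> N (mcomp d v).

Definition rspan p q (A : 'M[R]_(p, q)) : 'rV[R]_q -> Prop :=
  fun v => exists w, w *m A = v.

Definition rker p q (A : 'M[R]_(p, q)) : 'rV[R]_p -> Prop := fun v => v *m A = 0.

Lemma submodB q (N : 'rV[R]_q -> Prop) u v : submod N -> N u -> N v -> N (u - v).
Proof. by case=> _ hD hZ hu hv; apply: hD => //; rewrite -scaleN1r; apply: hZ. Qed.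

Lemma submod_sum q (N : 'rV[R]_q -> Prop) (T : finType) (F : T -> 'rV[R]_q) :
  submod N -> (forall i, N (F i)) -> N (\sum_i F i).
Proof. by case=> h0 hD _ h; apply: big_ind. Qed.

Lemma submod_mulmx q (N : 'rV[R]_q -> Prop) p (A : 'M[R]_(p, q)) w :
  submod N -> (forall i, N (row i A)) -> N (w *m A).
Proof.
move=> sN h; rewrite mulmx_sum_row; apply: submod_sum => // i.
by case: sN => _ _; apply.
Qed.

Lemma submod_comps q (N : 'rV[R]_q -> Prop) v :
  submod N -> (forall d, N (mcomp d v)) -> N v.
Proof. by move=> sN h; have [k ->] := mcomp_partition v; apply: submod_sum. Qed.

Lemma submod_rspan p q (A : 'M[R]_(p, q)) : submod (rspan A).
Proof.
split=> [|_ _ [u <-] [v <-]|c _ [v <-]]; first by exists 0; rewrite mul0mx.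
  by exists (u + v); rewrite mulmxDl.
by exists (c *: v); rewrite scalemxAl.
Qed.

Lemma rspan_row p q (A : 'M[R]_(p, q)) i : rspan A (row i A).
Proof. by exists (delta_mx 0 i); rewrite -rowE. Qed.

Lemma graded_rspan s p q (A : 'M[R]_(p, q)) : mhomog s A -> graded_submod (rspan A).
Proof.
move=> hA; split; first exact: submod_rspan.
move=> _ d [w <-]; have [le|lt] := leqP s d; last first.
  by rewrite (mcompM_low _ hA lt); exists 0; rewrite mul0mx.
by rewrite -(subnK le) mcompM //; exists (mcomp (d - s) w).
Qed.

Lemma graded_rker s p q (A : 'M[R]_(p, q)) : mhomog s A -> graded_submod (rker A).
Proof.
move=> hA; split=> [|v d hv].
  split=> [|u v hu hv|c v hv]; rewrite /rker ?mul0mx //.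
    by rewrite mulmxDl hu hv addr0.
  by rewrite -scalemxAl hv scaler0.
by rewrite /rker -(mcompM d v hA) hv mcomp0.
Qed.

Lemma rspan_homog s d p q (A : 'M[R]_(p, q)) v :
  mhomog s A -> mhomog (d + s) v -> rspan A v ->
  exists2 w, mhomog d w & w *m A = v.
Proof.
move=> hA hv [w wE]; exists (mcomp d w); first exact: mcompP.
by rewrite -(mcompM _ _ hA) wE mcomp_id.
Qed.

Lemma rspan_homog_low s d p q (A : 'M[R]_(p, q)) v :
  mhomog s A -> mhomog d v -> (d < s)%N -> rspan A v -> v = 0.
Proof.
by move=> hA hv ds [w wE]; rewrite -(mcomp_id hv) -wE (mcompM_low _ hA).
Qed.

(* [s] is the degree of the generators of [N]; the syzygies are then linear in
   the preceding generators. *)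
Definition linres s q (N : 'rV[R]_q -> Prop) :=
  exists (rk : nat -> nat) (A : 'M[R]_(rk 0, q)) (D : forall i, 'M[R]_(rk i.+1, rk i)),
  [/\ mhomog s A, forall i, mhomog 1 (D i), forall v, N v <-> rspan A v,
      forall v, v *m A = 0 <-> rspan (D 0) v
    & forall i v, v *m D i = 0 <-> rspan (D i.+1) v].

Lemma linres_unfold s q (N : 'rV[R]_q -> Prop) : linres s N ->
  exists p (A : 'M[R]_(p, q)),
    [/\ mhomog s A, forall v, N v <-> rspan A v & linres 1 (rker A)].
Proof.
case=> rk [A [D [hA hD NA ex0 ex]]]; exists (rk 0), A; split=> //.
exists (fun i => rk i.+1), (D 0), (fun i => D i.+1); split=> //.
Qed.

Lemma linres_fold s q (N : 'rV[R]_q -> Prop) p (A : 'M[R]_(p, q)) :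
  mhomog s A -> (forall v, N v <-> rspan A v) -> linres 1 (rker A) -> linres s N.
Proof.
move=> hA NA [rk [B [D [hB hD kA ex0 ex]]]].
pose rk' i := if i is j.+1 then rk j else p.
exists rk', A.
exists (fun i => match i return 'M_(rk' i.+1, rk' i) with j.+1 => D j | _ => B end).
split=> //.
- by case.
- by case=> [|i] v; [rewrite ex0|rewrite ex].
Qed.

(** A resolution is an infinite object, so it is built from one-step data: an invariant [Q] that
    yields generators whose syzygies satisfy [Q] again, now in degree 1, is unrolled by choice. *)
Lemma linres_coind (Q : nat -> forall q, ('rV[R]_q -> Prop) -> Prop) :
  (forall s q (N : 'rV[R]_q -> Prop), Q s q N ->
    exists p (A : 'M[R]_(p, q)),
      [/\ mhomog s A, forall v, N v <-> rspan A v & Q 1 p (rker A)]) ->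
  forall s q (N : 'rV[R]_q -> Prop), Q s q N -> linres s N.
Proof.
move=> step s q N /step [p [A [hA NA QA]]]; apply: (linres_fold hA NA).
(* A state carries the rank of the current free module and a submodule with its proof of [Q]; the
   type of the next generator matrix depends on it. *)
pose state := {p & {N : 'rV[R]_p -> Prop | Q 1 p N}}.
have next (x : state) : {y : {p' & 'M[R]_(p', projT1 x)} |
   [/\ mhomog 1 (projT2 y), forall v, sval (projT2 x) v <-> rspan (projT2 y) v
     & Q 1 _ (rker (projT2 y))]}.
  apply: constructive_indefinite_description; case: x => p' [N' QN'] /=.
  by have [p2 [B hB]] := step _ _ _ QN'; exists (existT _ p2 B).
pose nx (x : state) : state :=
  existT _ (projT1 (sval (next x)))
    (exist _ (rker (projT2 (sval (next x)))) (let: And3 _ _ h := svalP (next x) in h)).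
pose x0 : state := existT _ p (exist _ (rker A) QA).
pose st i := iter i nx x0.
pose mat i : 'M[R]_(projT1 (st i.+1), projT1 (st i)) := projT2 (sval (next (st i))).
exists (fun i => projT1 (st i.+1)), (mat 0), (fun i => mat i.+1).
have H i : mhomog 1 (mat i) /\ forall v, sval (projT2 (st i)) v <-> rspan (mat i) v.
  by have [] := svalP (next (st i)).
split; first exact: (H 0).1.
- by move=> i; apply: (H i.+1).1.
- exact: (H 0).2.
- exact: (H 1).2.
- by move=> i; apply: (H i.+2).2.
Qed.

Lemma linres_graded s q (N : 'rV[R]_q -> Prop) : linres s N -> graded_submod N.
Proof.
move=> /linres_unfold [p [A [hA NA _]]]; have [[h0 hD hZ] hg] := graded_rspan hA.
split; first split.
- exact/NA.
- by move=> u v /NA hu /NA hv; apply/NA/hD.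
- by move=> c v /NA hv; apply/NA/hZ.
- by move=> v d /NA hv; apply/NA/hg.
Qed.

Lemma linres_ext s q (N N' : 'rV[R]_q -> Prop) :
  (forall v, N v <-> N' v) -> linres s N -> linres s N'.
Proof.
move=> e [rk [A [D [hA hD NA ex0 ex]]]]; exists rk, A, D; split=> // v.
by rewrite -e.
Qed.

Lemma linres_zero s q (N : 'rV[R]_q -> Prop) : (forall v, N v <-> v = 0) -> linres s N.
Proof.
move=> N0; exists (fun=> 0), 0, (fun=> 0).
split=> [||v||i v]; try by [move=> i j; rewrite mxE rpred0 | move=> k i j; rewrite mxE rpred0].
- by rewrite N0; split=> [->|[w <-]]; [exists 0|]; rewrite mulmx0.
- by move=> v; split=> _; [exists 0|]; rewrite ?mulmx0 // [v]thinmx0.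
- by split=> _; [exists 0|]; rewrite ?mulmx0 // [v]thinmx0.
Qed.

End RowModules.

(** * Bases, changes of generators and direct sums *)

Section LinearAlgebra.
Variable (K : fieldType).

Definition subspace p (W : 'rV[K]_p -> Prop) :=
  [/\ W 0, forall u v, W u -> W v -> W (u + v) & forall c v, W v -> W (c *: v)].

(** A matrix is enlarged by a vector of [W] outside its row space until none is left; [k] bounds the
    codimension of the row space. *)
Lemma subspace_mx p (W : 'rV[K]_p -> Prop) :
  subspace W -> exists M : 'M[K]_p, forall c, W c <-> (c <= M)%MS.
Proof.
move=> sW; case: (sW) => W0 WD WZ.
have ext k (M : 'M[K]_p) : (p - \rank M <= k)%N -> (forall c, (c <= M)%MS -> W c) ->
    exists M' : 'M[K]_p, forall c, W c <-> (c <= M')%MS.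
  elim: k M => [|k IH] M rM MW.
    exists M => c; split; last exact: MW.
    move=> _; apply: submx_full; rewrite /row_full eqn_leq rank_leq_row.
    by rewrite -subn_eq0 -leqn0.
  case: (classic (exists2 c, W c & ~~ (c <= M)%MS)) => [[c Wc ncM]|no]; last first.
    exists M => c; split; last exact: MW.
    by move=> Wc; case: (boolP (c <= M)%MS) => // ncM; case: no; exists c.
  apply: (IH (M + c)%MS); last first.
    move=> d /sub_addsmxP [[u v] /= ->]; apply: WD; first exact/MW/submxMl.
    by rewrite [v]mx11_scalar mul_scalar_mx; apply: WZ.
  have : (\rank M < \rank (M + c)%MS)%N.
    by rewrite rank_ltmx // ltmxE addsmxSl /= addsmx_sub submx_refl.
  by move: rM; lia.
apply: (ext p 0); first exact: leq_subr.
by move=> c; rewrite submx0 => /eqP ->.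
Qed.
End LinearAlgebra.

(** Bases of the two summands, stacked, form an invertible matrix; its inverse [Q] serves for
    changing generators. *)
Lemma direct_sum_basis (K : fieldType) p (W1 W2 : 'rV[K]_p -> Prop) :
  subspace W1 -> subspace W2 -> (forall c, W1 c -> W2 c -> c = 0) ->
  (forall c, exists c1 c2, [/\ W1 c1, W2 c2 & c = c1 + c2]) ->
  exists p1 p2 (P1 : 'M[K]_(p1, p)) (P2 : 'M[K]_(p2, p)) (Q : 'M[K]_(p, p1 + p2)),
  [/\ col_mx P1 P2 *m Q = 1%:M, Q *m col_mx P1 P2 = 1%:M,
      forall i, W1 (row i P1) & forall i, W2 (row i P2)].
Proof.
move=> /subspace_mx [M1 W1M] /subspace_mx [M2 W2M] disj cover.
pose P := col_mx (row_base M1) (row_base M2).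
have full : row_full P.
  apply/row_fullP.
  have sub i : (row i 1%:M <= P)%MS.
    have [c1 [c2 [/W1M h1 /W2M h2 ->]]] := cover (row i 1%:M).
    rewrite -addsmxE; apply: addmx_sub_adds; first by rewrite eq_row_base.
    by rewrite eq_row_base.
  by have /row_subP /submxP [D DE] := sub; exists D; rewrite -DE.
have cap0 : (M1 :&: M2)%MS = 0.
  apply/eqP; rewrite -submx0; apply/row_subP => i; rewrite submx0; apply/eqP.
  by apply: disj; [apply/W1M|apply/W2M]; apply: submx_trans (row_sub _ _) _;
     rewrite ?capmxSl ?capmxSr.
have free : row_free P.
  rewrite /row_free -addsmxE (adds_eqmx (eq_row_base M1) (eq_row_base M2)).
  by rewrite mxrank_disjoint_sum.
have /row_freeP [Q PQ] := free; have /row_fullP [Q' QP] := full.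
have eQ : Q' = Q by rewrite -[Q']mulmx1 -PQ mulmxA QP mul1mx.
exists (\rank M1), (\rank M2), (row_base M1), (row_base M2), Q; split=> //.
- by rewrite -eQ.
- by move=> i; apply/W1M; rewrite -(eq_row_base M1) row_sub.
- by move=> i; apply/W2M; rewrite -(eq_row_base M2) row_sub.
Qed.

(** The rows of [P1] span a complement of [W], hence are independent modulo [W]. This later
    separates generators independent modulo [z] from those divisible by [z]. *)
Lemma complement_basis (K : fieldType) p (W : 'rV[K]_p -> Prop) : subspace W ->
  exists p1 p2 (P1 : 'M[K]_(p1, p)) (P2 : 'M[K]_(p2, p)) (Q : 'M[K]_(p, p1 + p2)),
  [/\ col_mx P1 P2 *m Q = 1%:M, Q *m col_mx P1 P2 = 1%:M,
      forall c, W (c *m P1) -> c = 0 & forall i, W (row i P2)].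
Proof.
move=> sW; have [M WM] := subspace_mx sW.
have [|c hc /WM hW|c|p1 [p2 [P1 [P2 [Q [PQ QP W1 W2]]]]]] :=
  @direct_sum_basis K p (fun c => (c <= M^C)%MS) W _ sW.
- by split=> [|u v|c v]; [apply: sub0mx|apply: addmx_sub|apply: scalemx_sub].
- by apply/eqP; rewrite -submx0 -(capmx_compl M) sub_capmx hW.
- have /sub_addsmxP [[u v] /= ->] : (c <= M^C + M)%MS.
    by rewrite addsmxC submx_full // addsmx_compl_full.
  by exists (u *m M^C%MS), (v *m M); split=> //; [apply: submxMl|apply/WM/submxMl].
exists p1, p2, P1, P2, Q; split=> // c hc.
have c0 : c *m P1 = 0.
  apply/eqP; rewrite -submx0 -(capmx_compl M) sub_capmx; apply/andP; split; first exact/WM.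
  by rewrite mulmx_sum_row; apply: summx_sub => i _; apply: scalemx_sub.
have /(congr1 lsubmx) : row_mx c 0 = 0 :> 'rV_(p1 + p2).
  by rewrite -[LHS]mulmx1 -PQ mulmxA mul_row_col c0 mul0mx addr0 mul0mx.
by rewrite row_mxKl linear0.
Qed.

Section HomogeneousBasis.
Variables (K : fieldType) (n : nat).
Local Notation R := {mpoly K[n]}.
Local Notation cst := (map_mx (@mpolyC n K)).

(** The degree bound puts [V] inside a finite-dimensional space whose monomial basis is formed by
    the rows of [E]; a basis of the space of coefficient vectors is carried back. *)
Lemma bounded_basis q (V : 'rV[R]_q -> Prop) k :
  V 0 -> (forall u v, V u -> V v -> V (u + v)) -> (forall c v, V v -> V (c%:MP *: v)) ->
  (forall v j, V v -> (msize (v 0%R j) <= k)%N) ->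
  exists p (G : 'M[R]_(p, q)),
  [/\ forall i, V (row i G), forall v, V v -> exists c, v = cst c *m G
    & forall c : 'rV[K]_p, cst c *m G = 0 -> c = 0].
Proof.
move=> V0 VD VZ Vk.
pose T := ('I_q * 'X_{1..n < k})%type.
pose E : 'M[R]_(#|{: T}|, q) := \matrix_(i < #|{: T}|, j < q)
  (if (enum_val i).1 == j then 'X_[(enum_val i).2] else 0).
have coefE (c : 'rV[K]_#|{: T}|) j (m : 'X_{1..n < k}) :
    ((cst c *m E) 0 j)@_m = c 0 (enum_rank ((j, m) : T)).
  rewrite mxE raddf_sum (bigD1 (enum_rank ((j, m) : T))) //= big1 ?addr0.
    by rewrite !mxE enum_rankK /= eqxx mcoeffCM mcoeffX eqxx mulr1.
  move=> i ne; rewrite !mxE mcoeffCM.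
  case: eqP => [e1|]; last by rewrite mcoeff0 mulr0.
  rewrite mcoeffX; case: eqP => [/val_inj e2|]; last by rewrite mulr0.
  by move: ne; rewrite -e1 -e2 -surjective_pairing enum_valK eqxx.
have E_inj (c : 'rV[K]_#|{: T}|) : cst c *m E = 0 -> c = 0.
  move=> cE; apply/rowP => i; rewrite -[i]enum_valK; case: (enum_val i) => j m.
  by rewrite -coefE cE !mxE mcoeff0.
have spanE v : V v -> exists c, v = cst c *m E.
  move=> Vv; exists (\row_(i < #|{: T}|) (v 0 (enum_val i).1)@_(enum_val i).2).
  apply/rowP => j; apply/mpolyP => m.
  have [lt|ge] := ltnP (mdeg m) k; first by rewrite (coefE _ j (BMultinom lt)) mxE enum_rankK.
  rewrite memN_msupp_eq0; last by apply: contraL ge => /msize_mdeg_lt h; rewrite -ltnNge (leq_trans h) ?Vk.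
  rewrite mxE raddf_sum big1 // => i _ /=; rewrite !mxE mcoeffCM.
  case: eqP => [_|]; last by rewrite mcoeff0 mulr0.
  rewrite mcoeffX; case: eqP => [e|]; last by rewrite mulr0.
  by move: ge; rewrite -e leqNgt bmdeg.
have sW : subspace (fun c => V (cst c *m E)).
  split=> [|u v hu hv|c v hv]; first by rewrite map_mx0 mul0mx.
    by rewrite map_mxD mulmxDl; apply: VD.
  by rewrite map_mxZ -scalemxAl; apply: VZ.
have [M WM] := subspace_mx sW.
exists (\rank M), (cst (row_base M) *m E); split.
- move=> i; rewrite row_mul -map_row; apply/WM.
  by rewrite (submx_trans (row_sub _ _)) // eq_row_base.
- move=> v Vv; have [c cE] := spanE v Vv.
  have /submxP [d dE] : (c <= row_base M)%MS by rewrite eq_row_base; apply/WM; rewrite -cE.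
  by exists d; rewrite cE dE map_mxM mulmxA.
- move=> c; rewrite mulmxA -map_mxM => /E_inj cM.
  by apply: (row_free_inj (row_base_free M)); rewrite cM mul0mx.
Qed.

(** Minimality: the syzygies are generated in degree 1, so a constant one vanishes. *)
Lemma linres_indep p q (A : 'M[R]_(p, q)) (c : 'rV[K]_p) :
  linres 1 (rker A) -> cst c *m A = 0 -> c = 0.
Proof.
move=> /linres_unfold [p' [B [hB NB _]]] /NB cB.
have /matrixP e0 := rspan_homog_low hB (mhomogC _ c) (ltn0Sn 0) cB.
by apply/rowP => i; move: (e0 0 i); rewrite !mxE => /eqP; rewrite mpolyC_eq0 => /eqP.
Qed.

Lemma linres_basechange s q q' (N : 'rV[R]_q -> Prop) (C : 'M[K]_(q', q)) (C' : 'M[K]_(q, q')) :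
  C *m C' = 1%:M -> C' *m C = 1%:M -> linres s N -> linres s (fun v => N (v *m cst C)).
Proof.
move=> CC' C'C /linres_unfold [p [A [hA NA lA]]].
apply: (@linres_fold _ _ _ _ _ p (A *m cst C')).
- by rewrite -[s]addn0; apply/mhomogM/mhomogC.
- move=> v; rewrite NA; split=> [] [w wE]; exists w.
    by rewrite mulmxA wE -mulmxA -map_mxM CC' map_mx1 mulmx1.
  by rewrite -wE -!mulmxA -map_mxM C'C map_mx1 mulmx1.
- apply: linres_ext lA => v; rewrite /rker mulmxA; split=> [->|h]; first by rewrite mul0mx.
  by rewrite -[_ *m A]mulmx1 -(map_mx1 (@mpolyC n K)) -C'C map_mxM mulmxA h mul0mx.
Qed.

Lemma linres_change_gens q p p' (A : 'M[R]_(p, q)) (P : 'M[K]_(p', p)) (Q : 'M[K]_(p, p')) :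
  P *m Q = 1%:M -> Q *m P = 1%:M ->
  linres 1 (rker A) -> linres 1 (rker (cst P *m A)).
Proof.
move=> PQ QP lA; apply: linres_ext (linres_basechange PQ QP lA) => v.
by rewrite /rker mulmxA.
Qed.

Lemma rspan_change_gens q p p' (A : 'M[R]_(p, q)) (P : 'M[K]_(p', p)) (Q : 'M[K]_(p, p')) v :
  Q *m P = 1%:M -> rspan A v <-> rspan (cst P *m A) v.
Proof.
move=> QP; split=> [[w <-]|[w <-]]; last by exists (w *m cst P); rewrite mulmxA.
by exists (w *m cst Q); rewrite mulmxA -(mulmxA w) -map_mxM QP map_mx1 mulmx1.
Qed.
End HomogeneousBasis.

Section DirectSums.
Variables (K : fieldType) (n : nat).
Local Notation R := {mpoly K[n]}.
Local Notation cst := (map_mx (@mpolyC n K)).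

Definition dsum q1 q2 (N1 : 'rV[R]_q1 -> Prop) (N2 : 'rV[R]_q2 -> Prop) :
    'rV[R]_(q1 + q2) -> Prop :=
  fun v => N1 (lsubmx v) /\ N2 (rsubmx v).

Lemma mul_block_diag p1 p2 q1 q2 (A1 : 'M[R]_(p1, q1)) (A2 : 'M[R]_(p2, q2)) v :
  v *m block_mx A1 0 0 A2 = row_mx (lsubmx v *m A1) (rsubmx v *m A2) :> 'rV_(_ + _).
Proof. by rewrite -{1}[v]hsubmxK mul_row_block !mulmx0 addr0 add0r. Qed.

Lemma mhomog_block_diag s p1 p2 q1 q2 (A1 : 'M[R]_(p1, q1)) (A2 : 'M[R]_(p2, q2)) :
  mhomog s A1 -> mhomog s A2 -> mhomog s (block_mx A1 0 0 A2).
Proof.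
move=> h1 h2; apply/mhomog_col_mx.
by split; apply/mhomog_row_mx; split=> //; apply: mhomog0.
Qed.

Lemma rker_block_diag p1 p2 q1 q2 (A1 : 'M[R]_(p1, q1)) (A2 : 'M[R]_(p2, q2)) v :
  rker (block_mx A1 0 0 A2) v <-> dsum (rker A1) (rker A2) v.
Proof.
rewrite /rker /dsum mul_block_diag; split=> [|[-> ->]]; last exact: row_mx0.
by rewrite -(row_mx0 _ 1 q1 q2) => /eq_row_mx [].
Qed.

Lemma rspan_block_diag p1 p2 q1 q2 (A1 : 'M[R]_(p1, q1)) (A2 : 'M[R]_(p2, q2)) v :
  rspan (block_mx A1 0 0 A2) v <-> dsum (rspan A1) (rspan A2) v.
Proof.
split=> [[w <-]|[[w1 e1] [w2 e2]]].
  by rewrite mul_block_diag /dsum row_mxKl row_mxKr; split; [exists (lsubmx w)|exists (rsubmx w)].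
by exists (row_mx w1 w2); rewrite mul_block_diag row_mxKl row_mxKr e1 e2 hsubmxK.
Qed.

(** Coinduction invariant. [N] is only equivalent to a direct sum, because the syzygies of a block
    diagonal matrix are one only up to equivalence of predicates. *)
Variant sum_of_linres : nat -> forall q, ('rV[R]_q -> Prop) -> Prop :=
  SumOfLinres s q1 q2 (N1 : 'rV[R]_q1 -> Prop) (N2 : 'rV[R]_q2 -> Prop) N of
    linres s N1 & linres s N2 & (forall v, N v <-> dsum N1 N2 v) :
    @sum_of_linres s (q1 + q2) N.

Lemma linres_dsum s q1 q2 (N1 : 'rV[R]_q1 -> Prop) (N2 : 'rV[R]_q2 -> Prop) :
  linres s N1 -> linres s N2 -> linres s (dsum N1 N2).
Proof.
move=> l1 l2; apply: (@linres_coind _ _ sum_of_linres); last exact: SumOfLinres l1 l2 _.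
move=> {}s q N [{}s {}q1 {}q2 {}N1 {}N2 {}N {}l1 {}l2 NE].
have [p1 [A1 [h1 e1 k1]]] := linres_unfold l1.
have [p2 [A2 [h2 e2 k2]]] := linres_unfold l2.
exists (p1 + p2), (block_mx A1 0 0 A2); split; first exact: mhomog_block_diag.
  by move=> v; rewrite NE rspan_block_diag /dsum e1 e2.
by apply: SumOfLinres k1 k2 _ => v; rewrite rker_block_diag.
Qed.

Definition summand_of_linres s q1 (N1 : 'rV[R]_q1 -> Prop) :=
  exists q2 (N2 : 'rV[R]_q2 -> Prop), linres s (dsum N1 N2).

(** A generator matrix of the sum need not respect the summands. A constant change of generators
    makes it block diagonal; its syzygies are then again a direct sum, and the argument repeats. *)
Lemma linres_summand s q1 q2 (N1 : 'rV[R]_q1 -> Prop) (N2 : 'rV[R]_q2 -> Prop) :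
  linres s (dsum N1 N2) -> linres s N1.
Proof.
move=> l12; apply: (@linres_coind _ _ summand_of_linres); last by exists q2, N2.
move=> {q1 q2 N1 N2 l12}s q1 N1 [q2 [N2 l12]].
have [[[]]] := linres_graded l12; rewrite /dsum !linear0 => N10 N20 _ _ _.
have [p [A [hA eA kA]]] := linres_unfold l12.
(* [W1] and [W2] collect the constant combinations of generators lying in the first and in the
   second summand. *)
pose W1 (c : 'rV[K]_p) := rsubmx (cst c *m A) = 0.
pose W2 (c : 'rV[K]_p) := lsubmx (cst c *m A) = 0.
have sW1 : subspace W1.
  rewrite /W1; split=> [|u v hu hv|c v hv]; first by rewrite map_mx0 mul0mx linear0.
    by rewrite map_mxD mulmxDl linearD /= hu hv addr0.
  by rewrite map_mxZ -scalemxAl linearZ /= hv scaler0.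
have sW2 : subspace W2.
  rewrite /W2; split=> [|u v hu hv|c v hv]; first by rewrite map_mx0 mul0mx linear0.
    by rewrite map_mxD mulmxDl linearD /= hu hv addr0.
  by rewrite map_mxZ -scalemxAl linearZ /= hv scaler0.
have gens v : mhomog s v -> dsum N1 N2 v -> exists c : 'rV[K]_p, cst c *m A = v.
  move=> hv /eA /(rspan_homog (d := 0) hA hv) [w hw <-].
  by rewrite (mhomog0E hw); eexists.
have [|c|p1 [p2 [P1 [P2 [Q [PQ QP W1P W2P]]]]]] := @direct_sum_basis K p W1 W2 sW1 sW2.
(* A combination with both components zero is a constant syzygy. *)
- move=> c h1 h2; apply: (linres_indep kA); rewrite -[LHS]hsubmxK [lsubmx _]h2 [rsubmx _]h1.
  exact: row_mx0.
(* Each component of a degree [s] element of the sum lies in the sum again, so it is itself a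
   constant combination of the generators. *)
- have hcA : mhomog s (cst c *m A) by apply: (mhomogM (d := 0)) => //; apply: mhomogC.
  have [hl hr] : mhomog s (lsubmx (cst c *m A)) /\ mhomog s (rsubmx (cst c *m A)).
    by apply/mhomog_row_mx; rewrite hsubmxK.
  have [N1c N2c] : dsum N1 N2 (cst c *m A) by apply/eA; exists (cst c).
  have [||c1 c1E] := gens (row_mx (lsubmx (cst c *m A)) 0).
  + by apply/mhomog_row_mx; split=> //; apply: mhomog0.
  + by rewrite /dsum row_mxKl row_mxKr.
  have [||c2 c2E] := gens (row_mx 0 (rsubmx (cst c *m A))).
  + by apply/mhomog_row_mx; split=> //; apply: mhomog0.
  + by rewrite /dsum row_mxKl row_mxKr.
  exists c1, c2; split; first by rewrite /W1 c1E row_mxKr.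
    by rewrite /W2 c2E row_mxKl.
  apply/eqP; rewrite -subr_eq0; apply/eqP/(linres_indep kA).
  rewrite map_mxB map_mxD mulmxBl mulmxDl c1E c2E add_row_mx addr0 add0r hsubmxK.
  exact: subrr.
pose B1 := lsubmx (cst P1 *m A); pose B2 := rsubmx (cst P2 *m A).
have blk : cst (col_mx P1 P2) *m A = block_mx B1 0 0 B2.
  rewrite map_col_mx mul_col_mx; congr col_mx; rewrite -[LHS]hsubmxK; congr row_mx.
    apply/row_matrixP => i; rewrite row0 -[RHS](W1P i) map_row -row_mul.
    by apply/rowP => j; rewrite !mxE.
  apply/row_matrixP => i; rewrite row0 -[RHS](W2P i) map_row -row_mul.
  by apply/rowP => j; rewrite !mxE.
have hblk : mhomog s (block_mx B1 0 0 B2).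
  by rewrite -blk; apply: (mhomogM (d := 0)) => //; apply: mhomogC.
have [hB1 _] : mhomog s (row_mx B1 (0 : 'M_(_, q2))) /\ mhomog s (row_mx (0 : 'M_(_, q1)) B2).
  exact/mhomog_col_mx.
exists p1, B1; split; first by have [] := (mhomog_row_mx s B1 (0 : 'M_(_, q2))).1 hB1.
- move=> v; transitivity (dsum N1 N2 (row_mx v 0)).
    by rewrite /dsum row_mxKl row_mxKr; split=> [|[]].
  rewrite eA (rspan_change_gens A _ QP) blk rspan_block_diag /dsum row_mxKl row_mxKr.
  by split=> [[]|h] //; split=> //; exists 0; rewrite mul0mx.
- exists p2, (rker B2); apply: linres_ext (linres_change_gens PQ QP kA) => v.
  by rewrite blk rker_block_diag.
Qed.
End DirectSums.

(** * Reduction modulo a linear form *)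

Lemma principal_idealP (K : fieldType) n (z f : {mpoly K[n]}) :
  principal_ideal z f <-> exists g, f = z * g.
Proof.
split=> [[k [c [g [gz ->]]]]|[g ->]].
  exists (\sum_i c i); rewrite mulr_sumr; apply: eq_bigr => i _.
  by rewrite gz mulrC.
by exists 1%N, (fun=> g), (fun=> z); split=> //; rewrite big_ord1 mulrC.
Qed.

Section Quotient.
Variables (K : fieldType) (n : nat) (z : {mpoly K[n.+1]}).
Variable phi : {lrmorphism {mpoly K[n.+1]} -> {mpoly K[n]}}.
Hypotheses (hphi : is_quotient_by z phi) (hz : z \is 1.-homog) (z0 : z != 0).
Local Notation R := {mpoly K[n.+1]}.
Local Notation Rb := {mpoly K[n]}.
Local Notation "A ^phi" := (map_mx phi A) (at level 1, format "A ^phi").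

Lemma quotient_homog d f : f \is d.-homog -> phi f \is d.-homog.
Proof.
have [hX _ _] := hphi => /dhomogP hf; rewrite [f]mpolyE linear_sum /=.
rewrite big_seq; apply: rpred_sum => m /hf md; rewrite linearZ /=; apply: rpredZ.
rewrite mpolyXE_id rmorph_prod -(md : mdeg m = d) mdegE /=.
elim/big_rec2: _ => [|i d' g _ hg]; first exact: dhomog1.
by apply: dhomogM => //; rewrite rmorphXn; apply: dhomog_eq (mul1n _) (dhomogMn _ (hX i)).
Qed.

Lemma quotient_hcomp d f : phi (hcomp d f) = hcomp d (phi f).
Proof.
pose k := maxn (mmeasure mdeg f) d.+1.
have lt : (d < k)%N by rewrite leq_maxr.
have -> : phi f = \sum_(i < k) phi (hcomp i f).
  by rewrite {1}(@pihomog_partitionE _ _ mdeg k f) ?leq_maxl // linear_sum.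
rewrite [RHS]linear_sum (bigD1 (Ordinal lt)) //= big1 ?addr0.
  by rewrite [RHS]pihomog_dE //; apply/quotient_homog/pihomogP.
move=> i ne; apply: (hcomp_ne (d := i)); last exact/quotient_homog/pihomogP.
exact: ne.
Qed.

Lemma quotient_ker f : phi f = 0 <-> exists g, f = z * g.
Proof. by have [_ _ ker] := hphi; rewrite ker principal_idealP. Qed.

Lemma quotient_z : phi z = 0.
Proof. by apply/quotient_ker; exists 1; rewrite mulr1. Qed.

Lemma quotient_mhomog d p q (A : 'M[R]_(p, q)) : mhomog d A -> mhomog d A^phi.
Proof. by move=> hA i j; rewrite mxE quotient_homog. Qed.

Lemma quotient_mcomp d p q (A : 'M[R]_(p, q)) : (mcomp d A)^phi = mcomp d A^phi.
Proof. by apply/matrixP => i j; rewrite !mxE quotient_hcomp. Qed.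

Lemma quotient_lift_mx p q (B : 'M[Rb]_(p, q)) : exists A, A^phi = B.
Proof.
have [_ surj _] := hphi.
pose sec g := sval (constructive_indefinite_description _ (surj g)).
have secK g : phi (sec g) = g by rewrite /sec; case: constructive_indefinite_description.
by exists (map_mx sec B); apply/matrixP => i j; rewrite !mxE secK.
Qed.

Lemma quotient_lift_homog d p q (B : 'M[Rb]_(p, q)) :
  mhomog d B -> exists2 A, mhomog d A & A^phi = B.
Proof.
move=> hB; have [A AB] := quotient_lift_mx B.
by exists (mcomp d A); [apply: mcompP | rewrite quotient_mcomp AB mcomp_id].
Qed.

Lemma quotient_ker_mx p q (A : 'M[R]_(p, q)) : A^phi = 0 -> exists B : 'M[R]_(p, q), A = z *: B.
Proof.
move=> /matrixP A0.
have /fin_all_exists [B BE] : forall ij : 'I_p * 'I_q, exists g, A ij.1 ij.2 = z * g.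
  by move=> [i j]; apply/quotient_ker; move: (A0 i j); rewrite !mxE.
by exists (\matrix_(i, j) B (i, j)); apply/matrixP => i j; rewrite !mxE -(BE (i, j)).
Qed.

Lemma quotient_zmx p q (A : 'M[R]_(p, q)) : (z *: A)^phi = 0.
Proof. by apply/matrixP => i j; rewrite !mxE rmorphM /= quotient_z mul0r. Qed.

Lemma quotient_ker_homog d p q (A : 'M[R]_(p, q)) :
  mhomog d.+1 A -> A^phi = 0 -> exists2 B : 'M[R]_(p, q), mhomog d B & A = z *: B.
Proof.
move=> hA /quotient_ker_mx [B AB]; exists (mcomp d B); first exact: mcompP.
by rewrite -(mcompZ _ _ hz) addn1 -AB mcomp_id.
Qed.

Lemma scale_z_inj p q (A B : 'M[R]_(p, q)) : z *: A = z *: B -> A = B.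
Proof.
move=> /matrixP e; apply/matrixP => i j; move: (e i j); rewrite !mxE.
exact: mulfI.
Qed.

Lemma scale_z_homog0 p q (A : 'M[R]_(p, q)) : mhomog 0 (z *: A) -> A = 0.
Proof.
move=> /mcomp_id; rewrite (mcompZ_low _ hz) // => e.
by apply: scale_z_inj; rewrite -e scaler0.
Qed.

Definition mimage q (N : 'rV[R]_q -> Prop) : 'rV[Rb]_q -> Prop :=
  fun u => exists2 v, N v & v^phi = u.

(** This is [z]-torsion freeness of the quotient by [N], under which resolutions can be reduced
    modulo [z] and lifted back. *)
Definition saturated q (N : 'rV[R]_q -> Prop) := forall v, N (z *: v) -> N v.

Lemma saturated_rker p q (A : 'M[R]_(p, q)) : saturated (rker A).
Proof.
by move=> v; rewrite /rker -scalemxAl => e; apply: scale_z_inj; rewrite e scaler0.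
Qed.

Variant image_of_linres : nat -> forall q, ('rV[Rb]_q -> Prop) -> Prop :=
  ImageOfLinres s q (N : 'rV[R]_q -> Prop) Nb of
    linres s N & saturated N & (forall u, Nb u <-> mimage N u) :
    @image_of_linres s q Nb.

(** Saturation makes every syzygy of the reduced generators the reduction of a syzygy. Syzygy
    modules are saturated, so this repeats along the resolution. *)
Lemma linres_image s q (N : 'rV[R]_q -> Prop) :
  linres s N -> saturated N -> linres s (mimage N).
Proof.
move=> lN sN; apply: (@linres_coind _ _ image_of_linres); last exact: ImageOfLinres lN sN _.
move=> {}s {}q _ [{}s {}q {}N Nb {}lN {}sN NbE].
have [p [A [hA eA kA]]] := linres_unfold lN.
exists p, A^phi; split; first exact: quotient_mhomog.
  move=> u; rewrite NbE; split=> [[v /eA [w <-] <-]|[w <-]].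
    by exists w^phi; rewrite map_mxM.
  have [w' <-] := quotient_lift_mx w; exists (w' *m A); last by rewrite map_mxM.
  by apply/eA; exists w'.
apply: (ImageOfLinres kA); first exact: saturated_rker.
move=> u; split=> [|[v hv <-]]; last by rewrite /rker -map_mxM hv map_mx0.
(* If [v *m A] is [z *: a], saturation gives [a = w *m A], and [v - z *: w] is a syzygy with the
   same reduction as [v]. *)
have [v <-] := quotient_lift_mx u; rewrite /rker -map_mxM => /quotient_ker_mx [a vA].
have /eA [w wA] : N a by apply: sN; rewrite -vA; apply/eA; exists v.
exists (v - z *: w); last by rewrite map_mxB quotient_zmx subr0.
by rewrite /rker mulmxBl -scalemxAl wA vA subrr.
Qed.

Variant lift_of_linres : nat -> forall q, ('rV[R]_q -> Prop) -> Prop :=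
  LiftOfLinres s q (N : 'rV[R]_q -> Prop) of
    graded_submod N & saturated N & linres s (mimage N) : @lift_of_linres s q N.

Lemma homog_mod_image q (N : 'rV[R]_q -> Prop) s u :
  graded_submod N -> mhomog s u -> mimage N u ->
  exists v, [/\ N v, mhomog s v & v^phi = u].
Proof.
move=> [_ gN] hu [v Nv vu]; exists (mcomp s v); split; first exact: gN.
  exact: mcompP.
by rewrite quotient_mcomp vu mcomp_id.
Qed.

Lemma lift_gens s p q (N : 'rV[R]_q -> Prop) (B : 'M[Rb]_(p, q)) :
  graded_submod N -> mhomog s B -> (forall u, mimage N u <-> rspan B u) ->
  exists A, [/\ mhomog s A, forall i, N (row i A) & A^phi = B].
Proof.
move=> gN hB eB.
have /fin_all_exists [a aE] : forall i, exists v, [/\ N v, mhomog s v & v^phi = row i B].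
  move=> i; apply: homog_mod_image => //; first exact: mhomog_row.
  by apply/eB/rspan_row.
exists (\matrix_i a i); split=> [i j|i|]; first by rewrite mxE; case: (aE i).
  by rewrite rowK; case: (aE i).
by apply/row_matrixP => i; rewrite -map_row rowK; case: (aE i).
Qed.

(** Graded Nakayama lemma: subtracting a combination of the rows leaves some [z *: a]; saturation
    puts [a] in [N], one degree lower, and induction on the degree finishes. *)
Lemma rspan_of_image s p q (N : 'rV[R]_q -> Prop) (A : 'M[R]_(p, q)) :
  graded_submod N -> saturated N -> mhomog s A -> (forall i, N (row i A)) ->
  (forall u, mimage N u -> rspan A^phi u) -> forall v, N v <-> rspan A v.
Proof.
move=> [sm gN] sN hA NA im v; split=> [Nv|[w <-]]; last exact: submod_mulmx.
apply: submod_comps => [|d]; first exact: submod_rspan.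
have [_ _ rZ] := submod_rspan A; have [_ rD _] := submod_rspan A.
move: {v Nv}(mcomp d v) (gN v d Nv) (mcompP d v) => v.
have reduce e u : N u -> mhomog e u -> exists w,
    [/\ N (u - w *m A), mhomog e (u - w *m A) & (u - w *m A)^phi = 0].
  move=> Nu hu; have r : rspan A^phi u^phi by apply: im; exists u.
  have [le|lt] := leqP s e; last first.
    exists 0; rewrite mul0mx subr0; split=> //.
    exact: rspan_homog_low (quotient_mhomog hA) (quotient_mhomog hu) lt r.
  rewrite -(subnK le) in hu *.
  have [wb hwb wbE] := rspan_homog (quotient_mhomog hA) (quotient_mhomog hu) r.
  have [w hw wwb] := quotient_lift_homog hwb; exists w; split.
  - by apply: submodB => //; apply: submod_mulmx.
  - by apply: mhomogB => //; apply: mhomogM.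
  - by rewrite map_mxB map_mxM wwb wbE subrr.
elim: d v => [|d IH] v Nv /(reduce _ _ Nv) [w [Nu hu u0]];
  rewrite -[v](subrK (w *m A)); apply: rD; try by exists w.
  have [a aE] := quotient_ker_mx u0; rewrite aE in hu *.
  by rewrite (scale_z_homog0 hu) scaler0; exists 0; rewrite mul0mx.
have [a ha aE] := quotient_ker_homog hu u0; rewrite aE in Nu *.
by apply: rZ; apply: IH => //; apply: sN.
Qed.

(** Homogeneous lifts of generators of the image generate [N], and their syzygies reduce onto the
    syzygies of the image, so the situation recurs. *)
Lemma linres_lift s q (N : 'rV[R]_q -> Prop) :
  graded_submod N -> saturated N -> linres s (mimage N) -> linres s N.
Proof.
move=> gN sN lN; apply: (@linres_coind _ _ lift_of_linres); last exact: LiftOfLinres.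
move=> {}s {}q _ [{}s {}q {}N {}gN {}sN {}lN].
have [p [B [hB eB kB]]] := linres_unfold lN.
have [A [hA rA AB]] := lift_gens gN hB eB.
have NA : forall v, N v <-> rspan A v.
  by apply: (rspan_of_image gN sN hA rA) => u; rewrite AB eB.
exists p, A; split=> //.
apply: LiftOfLinres; [exact: graded_rker hA|exact: saturated_rker|].
apply: linres_ext kB => u; split=> [|[v hv <-]]; last by rewrite /rker -AB -map_mxM hv map_mx0.
have [v <-] := quotient_lift_mx u; rewrite /rker -AB -map_mxM => /quotient_ker_mx [b vA].
have /NA [w wA] : N b by apply: sN; rewrite -vA; apply/NA; exists v.
exists (v - z *: w); last by rewrite map_mxB quotient_zmx subr0.
by rewrite /rker mulmxBl -scalemxAl wA vA subrr.
Qed.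

End Quotient.

(** * Existence of the quotient by a linear form *)

Lemma mpoly_gen_ind (K : fieldType) n (P : {mpoly K[n]} -> Prop) :
  (forall c, P c%:MP) -> (forall f g, P f -> P g -> P (f + g)) ->
  (forall f g, P f -> P g -> P (f * g)) -> (forall i, P 'X_i) -> forall f, P f.
Proof.
move=> PC PD PM PX; elim/mpolyind => [|c m f _ _ Pf]; first by rewrite -mpolyC0.
apply: PD => //; rewrite -mul_mpolyC; apply: (PM) => //; rewrite mpolyXE_id.
apply: (big_ind P) => [|f1 f2|i _]; [by rewrite -mpolyC1 | exact: PM | ].
by elim: (m i) => [|k IH]; rewrite ?expr0 -?mpolyC1 // exprS; apply: (PM).
Qed.

(** Every monomial of positive degree contains a variable, which is split off. *)
Lemma dhomogS (K : fieldType) n d (f : {mpoly K[n]}) : f \is d.+1.-homog ->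
  exists2 g : 'I_n -> {mpoly K[n]}, forall i, g i \is d.-homog & f = \sum_i 'X_i * g i.
Proof.
move=> /dhomogP hf; rewrite [f]mpolyE big_seq.
apply: (big_ind (fun f => exists2 g : 'I_n -> {mpoly K[n]},
  forall i, g i \is d.-homog & f = \sum_i 'X_i * g i)) => [|f1 f2|m /hf].
- by exists (fun=> 0) => [i|]; rewrite ?rpred0 // big1 // => i; rewrite mulr0.
- move=> [g1 h1 ->] [g2 h2 ->]; exists (fun i => g1 i + g2 i) => [i|]; first by rewrite rpredD.
  by rewrite -big_split; apply: eq_bigr => i; rewrite mulrDr.
- move=> md; have md' : mdeg m = d.+1 := md.
  have [i mi] : exists i, (0 < m i)%N.
    apply/existsP; apply: contra_eqT md'; rewrite negb_exists => /forallP h.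
    by rewrite mdegE big1 // => i _; apply/eqP; rewrite -leqn0 leqNgt h.
  have le : (U_(i) <= m)%MM.
    by apply/mnm_lepP => j; rewrite mnm1E; case: eqP => [<-|].
  exists (fun j => if j == i then f@_m *: 'X_[m - U_(i)] else 0) => [j|].
    case: ifP => _; last exact: rpred0.
    rewrite rpredZ // dhomogX; apply/eqP => /=; rewrite -[mdeg _]/(mdeg (m - U_(i))%MM).
    by have := congr1 mdeg (submK le); rewrite mdegD mdeg1 md' addn1 => -[].
  rewrite (bigD1 i) //= eqxx big1 ?addr0 => [|j /negPf->]; last by rewrite mulr0.
  by rewrite -scalerAr -mpolyXD addmC submK.
Qed.

Lemma dhomog1E (K : fieldType) n (f : {mpoly K[n]}) :
  f \is 1.-homog -> exists a, f = linear_form a.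
Proof.
move=> /dhomogS [g hg ->]; exists (fun i => (g i)@_0).
by apply: eq_bigr => i _; rewrite {1}(dhomog0E (hg i)) mulrC mul_mpolyC.
Qed.

Lemma linear_form_homog (K : fieldType) n (a : 'I_n -> K) : linear_form a \is 1.-homog.
Proof. by rewrite rpred_sum // => i _; rewrite rpredZ // dhomogXi. Qed.

Lemma exists_substitution (K : fieldType) n k (y : 'I_n -> {mpoly K[k]}) :
  exists psi : {lrmorphism {mpoly K[n]} -> {mpoly K[k]}}, forall j, psi 'X_j = y j.
Proof.
exists (comp_mpoly [tuple y j | j < n] : {lrmorphism {mpoly K[n]} -> {mpoly K[k]}}) => j.
by rewrite /= comp_mpolyXU -tnth_nth tnth_mktuple.
Qed.

Lemma lrmorphismC (K : fieldType) n k (psi : {lrmorphism {mpoly K[n]} -> {mpoly K[k]}}) c :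
  psi c%:MP = c%:MP.
Proof. by rewrite -[c%:MP]mulr1 mul_mpolyC linearZ /= rmorph1 -mul_mpolyC mulr1. Qed.

(** A variable with nonzero coefficient is eliminated by solving [z = 0]: [x] lists the images of
    the variables, [y] those under a section [psi]. Since [f] and [psi (phi f)] agree modulo [z],
    the kernel of [phi] is generated by [z]. *)
Lemma exists_quotient (K : fieldType) n (z : {mpoly K[n.+1]}) :
  z \is 1.-homog -> z != 0 ->
  exists phi : {lrmorphism {mpoly K[n.+1]} -> {mpoly K[n]}}, is_quotient_by z phi.
Proof.
move=> /dhomog1E [a ->] za.
have [i0 ai0] : exists i, a i != 0.
  apply/existsP; apply: contraR za; rewrite negb_exists => /forallP h.
  by rewrite /linear_form big1 // => i _; have /negPn/eqP-> := h i; rewrite scale0r.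
pose x : 'I_n.+1 -> {mpoly K[n]} := fun i =>
  if unlift i0 i is Some j then 'X_j else - \sum_j (a (lift i0 j) / a i0) *: 'X_j.
pose y : 'I_n -> {mpoly K[n.+1]} := fun j => 'X_(lift i0 j).
have [phi phiX] := exists_substitution x; have [psi psiX] := exists_substitution y.
have phiC := lrmorphismC phi; have psiC := lrmorphismC psi.
have xl j : x (lift i0 j) = 'X_j by rewrite /x liftK.
have x0 : x i0 = - \sum_j (a (lift i0 j) / a i0) *: 'X_j by rewrite /x unlift_none.
have zE : linear_form a = a i0 *: 'X_i0 + \sum_j a (lift i0 j) *: 'X_(lift i0 j).
  by rewrite /linear_form (bigD1_ord i0).
have phiz : phi (linear_form a) = 0.
  rewrite zE linearD linearZ linear_sum /= phiX x0 scalerN scaler_sumr addrC.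
  apply/eqP; rewrite subr_eq0; apply/eqP/eq_bigr => j _.
  by rewrite linearZ /= phiX xl scalerA mulrC divfK.
have phipsi g : phi (psi g) = g.
  elim/mpoly_gen_ind: g => [c|f g hf hg|f g hf hg|j]; first by rewrite psiC phiC.
  - by rewrite !rmorphD /= hf hg.
  - by rewrite !rmorphM /= hf hg.
  - by rewrite psiX phiX xl.
have psiphi f : exists g, f = psi (phi f) + linear_form a * g.
  elim/mpoly_gen_ind: f => [c|f g [f' hf] [g' hg]|f g [f' hf] [g' hg]|i].
  - by exists 0; rewrite phiC psiC mulr0 addr0.
  - by exists (f' + g'); rewrite {1}hf {1}hg !rmorphD /= mulrDr addrACA.
  - exists (f' * g + psi (phi f) * g'); rewrite !rmorphM /=.
    set A := psi (phi f) in hf *; set B := psi (phi g) in hg *.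
    rewrite [in LHS]hf mulrDl {1}hg !mulrDr -addrA; congr (_ + _); rewrite addrC.
    by rewrite -mulrA (mulrCA A).
  - case: (unliftP i0 i) => [j|] ->; first by exists 0; rewrite phiX xl psiX mulr0 addr0.
    exists ((a i0)^-1)%:MP; rewrite phiX x0 mulrC mul_mpolyC zE scalerDr scalerA mulVf // scale1r.
    rewrite rmorphN scaler_sumr rmorph_sum /= addrCA -[LHS]addr0; congr (_ + _).
    apply/esym/eqP; rewrite addr_eq0 eqr_opp; apply/eqP/eq_bigr => j _.
    by rewrite linearZ /= psiX scalerA mulrC.
exists phi; split=> [i|g|f].
- rewrite phiX /x; case: unlift => [j|]; first exact: dhomogXi.
  by rewrite rpredN rpred_sum // => j _; rewrite rpredZ // dhomogXi.
- by exists (psi g).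
- rewrite principal_idealP; split=> [f0|[g ->]]; last by rewrite rmorphM /= phiz mul0r.
  by have [g] := psiphi f; rewrite f0 rmorph0 add0r; exists g.
Qed.

(** * Socles, and linearity of a module against linearity of its image *)

(* Eliminate one variable z: from z v = c A for a generator matrix A of N, the
   row c is a socle element modulo the image of the syzygies of A in R/zR. *)
Lemma linres_socle (K : fieldType) n s q (N : 'rV[{mpoly K[n]}]_q -> Prop) e v :
  linres s N -> (s <= e)%N -> (0 < n + e)%N -> mhomog e v ->
  (forall f, f \is 1.-homog -> N (f *: v)) -> N v.
Proof.
elim: n s q N e v => [|n IH] s q N e v lN se ne hv hN.
  (* Without variables [ne] makes the degree positive, and forms of positive degree vanish. *)
  suff -> : v = 0 by have [[]] := linres_graded lN.
  by apply/rowP => j; rewrite mxE (dhomog_nvar0 _ (hv 0 j)).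
have hz : ('X_ord0 : {mpoly K[n.+1]}) \is 1.-homog by exact: dhomogXi.
have z0 : ('X_ord0 : {mpoly K[n.+1]}) != 0.
  by rewrite -msize_poly_eq0 msizeX.
have [phi hphi] := exists_quotient hz z0.
set z := 'X_ord0 in hz z0 hphi.
have [p [A [hA eA kA]]] := linres_unfold lN.
have e1s : (1 + e = (e - s).+1 + s)%N by lia.
have gens f : f \is 1.-homog -> exists2 c, mhomog (e - s).+1 c & c *m A = f *: v.
  move=> hf; apply: rspan_homog hA _ _; last by apply/eA/hN.
  by rewrite -e1s; apply: mhomogZ.
have [c hc cA] := gens z hz.
(* The induction hypothesis is applied to the syzygies, generated in degree 1; the degree
   [(e - s).+1] of [c] is at least 1. *)
have [k kK kc] : mimage phi (rker A) (map_mx phi c).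
  apply: (IH _ _ _ (e - s).+1 _ (linres_image hphi z0 kA (saturated_rker z0 (A := A)))) => //.
  - by rewrite addnS.
  - exact (quotient_mhomog hphi hc).
  move=> fb hfb.
  have hfm : mhomog 1 (fb%:M : 'M_1) by move=> i j; rewrite !ord1 mxE.
  have [F hF FE] := quotient_lift_homog hphi hfm.
  have [d hd dA] := gens (F 0 0) (hF 0 0).
  (* [c] and [d] represent the multiples of [v] by [z] and by the lifted form, so this is a
     syzygy. *)
  exists (F 0 0 *: c - z *: d).
    by rewrite /rker mulmxBl -!scalemxAl cA dA !scalerA mulrC subrr.
  rewrite map_mxB (quotient_zmx hphi) subr0; apply/rowP => j; rewrite !mxE /= rmorphM /=.
  by congr (_ * _); move/matrixP: FE => /(_ 0 0); rewrite !mxE.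
(* [c] differs from a syzygy by [z *: c'], so [z] cancels from [c *m A = z *: v]. *)
have /(quotient_ker_mx hphi) [c' cE] : map_mx phi (c - k) = 0 by rewrite map_mxB kc subrr.
apply/eA; exists c'; apply: (scale_z_inj z0).
by rewrite -cA scalemxAl -cE mulmxBl kK subr0.
Qed.

(* All entries lie in the maximal ideal. *)
Definition irrel (K : fieldType) n q (v : 'rV[{mpoly K[n]}]_q) := mcomp 0 v = 0.

Lemma irrel_dsum (K : fieldType) n q1 q2 (v : 'rV[{mpoly K[n]}]_(q1 + q2)) :
  dsum (@irrel K n q1) (@irrel K n q2) v <-> irrel v.
Proof.
rewrite /dsum /irrel; have <- : row_mx (mcomp 0 (lsubmx v)) (mcomp 0 (rsubmx v)) = mcomp 0 v.
  by rewrite -mcomp_row_mx hsubmxK.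
split=> [[-> ->]|]; first exact: row_mx0.
by rewrite -(row_mx0 _ 1 q1 q2) => /eq_row_mx [].
Qed.

Lemma linres_irrel (K : fieldType) n q :
  linres 1 (@irrel K n 1) -> linres 1 (@irrel K n q).
Proof.
move=> l1; elim: q => [|q IH].
  by apply: linres_zero => v; split=> _; rewrite /irrel [LHS]thinmx0.
exact: linres_ext (@irrel_dsum K n 1 q) (linres_dsum l1 IH).
Qed.

(** Generation is expressed by minimality among submodules, which avoids choosing generators. *)
Definition generated_in_degree (K : fieldType) n s q (N : 'rV[{mpoly K[n]}]_q -> Prop) :=
  forall M : 'rV[{mpoly K[n]}]_q -> Prop, submod M ->
  (forall v, N v -> mhomog s v -> M v) -> forall v, N v -> M v.

Section Transfer.
Variables (K : fieldType) (n : nat) (z : {mpoly K[n.+1]}).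
Variable phi : {lrmorphism {mpoly K[n.+1]} -> {mpoly K[n]}}.
Hypotheses (hphi : is_quotient_by z phi) (hz : z \is 1.-homog) (z0 : z != 0).
Local Notation R := {mpoly K[n.+1]}.
Local Notation Rb := {mpoly K[n]}.
Local Notation "A ^phi" := (map_mx phi A) (at level 1, format "A ^phi").
Local Notation cst := (map_mx (@mpolyC n.+1 K)).

Lemma quotient_cst p q (c : 'M[K]_(p, q)) : (cst c)^phi = map_mx (@mpolyC n K) c.
Proof. by apply/matrixP => i j; rewrite !mxE lrmorphismC. Qed.

Lemma quotient_scale p q f (A : 'M[R]_(p, q)) : (f *: A)^phi = phi f *: A^phi.
Proof. by apply/matrixP => i j; rewrite !mxE rmorphM. Qed.

Lemma scale_z_homog d p q (A : 'M[R]_(p, q)) : mhomog d.+1 (z *: A) -> mhomog d A.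
Proof.
move=> /mcomp_id; rewrite -[d.+1]addn1 (mcompZ _ _ hz) => /(scale_z_inj z0) <-.
exact: mcompP.
Qed.

Lemma submod_mimage q (N : 'rV[R]_q -> Prop) : submod N -> submod (mimage phi N).
Proof.
move=> [N0 ND NZ]; split=> [|_ _ [u hu <-] [v hv <-]|c _ [v hv <-]].
- by exists 0; rewrite ?map_mx0.
- by exists (u + v); rewrite ?map_mxD //; apply: ND.
- have [_ surj _] := hphi; have [c' <-] := surj c.
  by exists (c' *: v); [apply: NZ | rewrite quotient_scale].
Qed.

(* The generators of a module are split as the rows of [A], independent modulo
   z, and the rows of [z *: G]. *)
Section Syzygies.
Variables (s q p1 p2 : nat) (A : 'M[R]_(p1, q)) (G : 'M[R]_(p2, q)).
Local Notation B := (col_mx A (z *: G)).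
Local Notation S := (mimage phi (rker B)).

Lemma mem_rker_col x y : rker B (row_mx x y) <-> x *m A + z *: (y *m G) = 0.
Proof. by rewrite /rker mul_row_col -scalemxAr. Qed.

Lemma rspan_colE v : rspan B v -> exists x y, v = x *m A + z *: (y *m G).
Proof.
by move=> [w <-]; exists (lsubmx w), (rsubmx w); rewrite -{1}[w]hsubmxK mul_row_col -scalemxAr.
Qed.

(** With [w = a *m A + z *: (b *m G)], the row [(x - z a, - z b)] is a syzygy, and the corrections
    vanish modulo [z]. *)
Lemma syzygy_left x w : x *m A = z *: w -> rspan B w -> S (row_mx x^phi 0).
Proof.
move=> xA /rspan_colE [a [b wE]]; exists (row_mx (x - z *: a) (- (z *: b))).
  apply/mem_rker_col; rewrite mulmxBl mulNmx -!scalemxAl scalerN xA wE.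
  by rewrite scalerDr (addrC (z *: _)) addrK subrr.
by rewrite map_row_mx map_mxB map_mxN !(quotient_zmx hphi) subr0 oppr0.
Qed.

(** With [y *m G = a *m A + z *: (b *m G)], the row [(- z a, y - z b)] is a syzygy, the second block
    already containing a factor [z]. *)
Lemma syzygy_right y : rspan B (y *m G) -> S (row_mx 0 y^phi).
Proof.
move=> /rspan_colE [a [b wE]]; exists (row_mx (- (z *: a)) (y - z *: b)).
  apply/mem_rker_col; rewrite mulmxBl mulNmx -!scalemxAl wE.
  by rewrite addrK addNr.
by rewrite map_row_mx map_mxB map_mxN !(quotient_zmx hphi) subr0 oppr0.
Qed.

(** Modulo [z] the rows [z *: G] vanish, so the left part of a syzygy is one for the reduction of
    [A]; the right part has no constant term because constant syzygies are excluded. The last two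
    hypotheses give the reverse inclusion. *)
Lemma syzygy_image : mhomog s B ->
  (forall c, rker B (cst c) -> c = 0) ->
  (forall x, rker A^phi x -> S (row_mx x 0)) -> (forall y, irrel y -> S (row_mx 0 y)) ->
  forall u, S u <-> dsum (rker A^phi) (@irrel K n p2) u.
Proof.
move=> hB indep hl hr u; split=> [[v kv <-]|[ul ur]]; last first.
  have [_ SD _] := submod_mimage (graded_rker hB).1.
  by rewrite -[u]hsubmxK -[lsubmx u]addr0 -[rsubmx u]add0r -add_row_mx; apply: SD; [apply: hl|apply: hr].
have := kv; rewrite -{1}[v]hsubmxK => /mem_rker_col /(congr1 (map_mx phi)) e.
rewrite -[v]hsubmxK map_row_mx /dsum row_mxKl row_mxKr; split.
  by move: e; rewrite map_mxD (quotient_zmx hphi) addr0 map_mxM map_mx0.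
have kv0 : rker B (mcomp 0 v) by apply: (graded_rker hB).2.
have v0 : mcomp 0 v = 0.
  have E := mhomog0E (mcompP 0 v); rewrite E in kv0.
  by rewrite E (indep _ kv0) map_mx0.
rewrite /irrel -(quotient_mcomp hphi).
have -> : mcomp 0 (rsubmx v) = rsubmx (mcomp 0 v) by apply/matrixP => i j; rewrite !mxE.
by rewrite v0 linear0 map_mx0.
Qed.
End Syzygies.

(** The generators are changed so that some are independent modulo [z] and the others divisible by
    it. Their linear syzygy module then reduces to a direct sum with the syzygies of the image as a
    summand. *)
Lemma linres_quotient s q (N : 'rV[R]_q -> Prop) :
  linres s N ->
  (forall e v, (s <= e)%N -> mhomog e v -> N (z *: v) -> N v) -> linres s (mimage phi N).
Proof.
move=> lN colon; have [p [A0 [hA0 eA0 kA0]]] := linres_unfold lN.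
have [sN gN] := linres_graded lN; have [N0 ND NZ] := sN.
(* [W] describes the constant combinations of generators that are divisible by [z]. *)
pose W (c : 'rV[K]_p) := (cst c *m A0)^phi = 0.
have sW : subspace W.
  rewrite /W; split=> [|u v hu hv|c v hv]; first by rewrite map_mx0 mul0mx map_mx0.
    by rewrite map_mxD mulmxDl map_mxD hu hv addr0.
  by rewrite map_mxZ -scalemxAl quotient_scale hv scaler0.
have [p1 [p2 [P1 [P2 [Q [PQ QP W1 W2]]]]]] := complement_basis sW.
pose A := cst P1 *m A0.
have /(quotient_ker_mx hphi) [G GE] : (cst P2 *m A0)^phi = 0.
  apply/row_matrixP => i; rewrite row0 -map_row row_mul -map_row; exact: W2.
have BE : cst (col_mx P1 P2) *m A0 = col_mx A (z *: G).
  by rewrite map_col_mx mul_col_mx -GE.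
have hB : mhomog s (col_mx A (z *: G)).
  by rewrite -BE; apply: (mhomogM (d := 0)) => //; apply: mhomogC.
have [hA hG] := (mhomog_col_mx s A (z *: G)).1 hB.
have eB v : N v <-> rspan (col_mx A (z *: G)) v.
  by rewrite eA0 (rspan_change_gens A0 _ QP) BE.
have kB : linres 1 (rker (col_mx A (z *: G))).
  by rewrite -BE; apply: linres_change_gens QP kA0.
have NA i : N (row i A).
  by apply/eB; exists (row_mx (delta_mx 0 i) 0); rewrite mul_row_col mul0mx addr0 -rowE.
have NG i : N (row i (z *: G)).
  by apply/eB; exists (row_mx 0 (delta_mx 0 i)); rewrite mul_row_col mul0mx add0r -rowE.
have lS := linres_image hphi z0 kB (saturated_rker z0 (A := _)).
have [sS _] := linres_graded lS.
(* In degree 0, independence modulo [z] leaves no syzygy. In degree [e.+1], the [w] with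
   [x' *m A = z *: w] has degree [e + s], so the colon condition applies. *)
have left x : rker A^phi x -> mimage phi (rker (col_mx A (z *: G))) (row_mx x 0).
  move=> kx; have hAb := quotient_mhomog hphi hA.
  apply: submod_comps => // e; rewrite mcomp_row_mx mcomp0.
  have {kx} : rker A^phi (mcomp e x) by apply: (graded_rker hAb).2.
  move: (mcompP e x) => hx kx; move: hx kx; move: (mcomp e x) => {}x hx kx.
  have [x' hx' xE] := quotient_lift_homog hphi hx; rewrite -xE in kx hx *.
  have /(quotient_ker_mx hphi) [w wE] : (x' *m A)^phi = 0 by rewrite map_mxM.
  have hw : mhomog (e + s) (z *: w) by rewrite -wE; apply: mhomogM.
  case: e hx hx' hw => [|e] hx hx' hw.
    have xC := mhomog0E hx'; rewrite xC in kx *.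
    have -> : map_mx (mcoeff 0%MM) x' = 0.
      apply: W1; rewrite /W [cst (_ *m _)]map_mxM -mulmxA map_mxM; exact: kx.
    by rewrite !map_mx0 row_mx0; case: sS.
  apply: (syzygy_left wE); apply/eB; apply: (colon (e + s)%N); first exact: leq_addl.
    exact: scale_z_homog.
  by rewrite -wE; apply: submod_mulmx.
(* For a component of degree [e.+1], the row [y' *m G] is homogeneous of degree [e + s], and its
   product with [z] lies in [N]. *)
have right y : irrel y -> mimage phi (rker (col_mx A (z *: G))) (row_mx 0 y).
  move=> y0; apply: submod_comps => // e; rewrite mcomp_row_mx mcomp0.
  case: e => [|e]; first by rewrite y0 row_mx0; case: sS.
  have [y' hy' <-] := quotient_lift_homog hphi (mcompP e.+1 y).
  have hzy : z *: (y' *m G) = y' *m (z *: G) by rewrite -scalemxAr.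
  apply: syzygy_right; apply/eB; apply: (colon (e + s)%N); first exact: leq_addl.
    by apply: scale_z_homog; rewrite hzy -[(e + s).+1]addSn; apply: mhomogM.
  by rewrite hzy; apply: submod_mulmx.
have SE := syzygy_image hB (fun c => linres_indep kB) left right.
apply: (@linres_fold _ _ _ _ _ _ A^phi); first exact (quotient_mhomog hphi hA).
  move=> u; split=> [[v /eB /rspan_colE [x [y ->]] <-]|[w <-]].
    by exists x^phi; rewrite map_mxD (quotient_zmx hphi) addr0 [RHS]map_mxM.
  have [w' <-] := quotient_lift_mx hphi w; exists (w' *m A); last by rewrite [LHS]map_mxM.
  exact: submod_mulmx.
by apply: (linres_summand (N2 := @irrel K n p2)); apply: linres_ext lS.
Qed.

(** Provides the bound for [bounded_basis]; [msize] exceeds the degree by one. *)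
Lemma msize_scale_z s f : z * f \is s.-homog -> (msize f <= s.+1)%N.
Proof.
move=> hf; have [->|f0] := eqVneq f 0; first by rewrite msize0.
have zs : (0 < msize z)%N by rewrite lt0n msize_poly_eq0.
apply: (@leq_trans (msize (z * f))).
  by rewrite msizeM //; case: (msize z) zs => // k _; rewrite addSn leq_addl.
by rewrite msizeE; apply/bigmax_leqP_seq => m /(dhomog_mf hf) <- _.
Qed.

(** Lifted generators of the image are completed by multiples of [z]. Modulo [z] the syzygies become
    a direct sum of linear modules, and as syzygy modules are saturated, linearity lifts. *)
Lemma linres_of_quotient s q (N : 'rV[R]_q -> Prop) :
  graded_submod N -> generated_in_degree s N ->
  (forall v, mhomog s v -> N (z *: v) -> N v) ->
  linres s (mimage phi N) -> linres 1 (@irrel K n 1) -> linres s N.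
Proof.
move=> gN genN colon lN lirr; have [sN gN2] := gN; have [N0 ND NZ] := sN.
(* Dividing by [z] the degree [s] elements of [N] that are multiples of [z] gives a
   finite-dimensional space; the rows of [G] will be a basis of it. *)
pose V v := N (z *: v) /\ mhomog s (z *: v).
have [||||p2 [G [VG spanG indG]]] := @bounded_basis K n.+1 q V s.+1.
- by rewrite /V scaler0; split=> //; apply: mhomog0.
- by move=> u v [Nu hu] [Nv hv]; rewrite /V scalerDr; split; [apply: ND|apply: mhomogD].
- move=> c v [Nv hv]; rewrite /V scalerA mulrC -scalerA; split; first exact: NZ.
  by apply: (mhomogZ (d := 0)) => //; apply: dhomogC.
- by move=> v j [_ hv]; apply: msize_scale_z; move: (hv 0 j); rewrite mxE.
have [p1 [Bb [hBb eBb kBb]]] := linres_unfold lN.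
have [A [hA NA AB]] := lift_gens hphi gN hBb eBb.
have hG : mhomog s (z *: G).
  by move=> i j; have [_ /(_ 0 j)] := VG i; rewrite !mxE.
have NG i : N (row i (z *: G)).
  by have [h _] := VG i; congr N: h; apply/rowP => j; rewrite !mxE.
have hB : mhomog s (col_mx A (z *: G)) by apply/mhomog_col_mx.
have spanV v : V v -> rspan (col_mx A (z *: G)) (z *: v).
  move=> /spanG [c ->]; exists (row_mx 0 (cst c)).
  by rewrite mul_row_col mul0mx add0r -scalemxAr.
have [_ rD _] := submod_rspan (col_mx A (z *: G)).
(* A degree [s] element of [N] minus a combination of the lifts is a multiple of [z], hence in the
   span of [z *: G]. *)
have degs v : N v -> mhomog s v -> rspan (col_mx A (z *: G)) v.
  move=> Nv hv; have hvb := quotient_mhomog hphi hv.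
  have /eBb r : mimage phi N v^phi by exists v.
  have [w hw wE] := rspan_homog (d := 0) hBb hvb r.
  have [w' hw' w'E] := quotient_lift_homog hphi hw.
  have hwA : mhomog s (w' *m A) by apply: (mhomogM (d := 0)).
  have /(quotient_ker_mx hphi) [u uE] : (v - w' *m A)^phi = 0.
    by rewrite map_mxB map_mxM w'E AB wE subrr.
  rewrite -[v](subrK (w' *m A)) uE; apply: rD.
    apply: spanV; rewrite /V -uE; split; last exact: mhomogB.
    by apply: submodB => //; apply: submod_mulmx.
  by exists (row_mx w' 0); rewrite mul_row_col mul0mx addr0.
have eB v : N v <-> rspan (col_mx A (z *: G)) v.
  split=> [|[w <-]]; first by apply: genN => //; apply: submod_rspan.
  apply: submod_mulmx => // i; rewrite -[i]splitK; case: (split i) => j /=.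
    by rewrite -[lshift _ _]/(lshift p2 j) rowKu.
  by rewrite rowKd.
have indep c : rker (col_mx A (z *: G)) (cst c) -> c = 0.
  rewrite -[c]hsubmxK map_row_mx => /mem_rker_col e.
  have cl : lsubmx c = 0.
    apply: (linres_indep kBb); move/(congr1 (map_mx phi)): e.
    by rewrite map_mxD (quotient_zmx hphi) addr0 map_mxM AB quotient_cst map_mx0.
  rewrite cl in e *; have cr : rsubmx c = 0.
    apply: indG; apply: (scale_z_inj z0).
    by rewrite scaler0 -[RHS]e map_mx0 mul0mx add0r.
  by rewrite cr row_mx0.
have sS := submod_mimage (graded_rker hB).1.
(* Only the degree 1 generators [C] of the syzygies need lifting, so the colon condition is used in
   degree [s] alone. *)
have left x : rker A^phi x -> mimage phi (rker (col_mx A (z *: G))) (row_mx x 0).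
  rewrite AB; have [p3 [C [hC eC _]]] := linres_unfold kBb; move=> /eC [w <-].
  rewrite -(mulmx0 _ w) -mul_mx_row; apply: submod_mulmx => // i; rewrite row_row_mx row0.
  have [x' hx' xE] := quotient_lift_homog hphi (mhomog_row i hC).
  have /(quotient_ker_mx hphi) [u uE] : (x' *m A)^phi = 0.
    by rewrite map_mxM xE AB; apply/eC/rspan_row.
  rewrite -xE; apply: (syzygy_left uE); apply/eB; apply: colon.
    by apply: scale_z_homog; rewrite -uE; apply: (mhomogM (d := 1)).
  by rewrite -uE; apply: submod_mulmx.
(* The vectors without constant term are generated in degree 1 as well, and [y' *m G] then has
   degree [s]. *)
have right y : irrel y -> mimage phi (rker (col_mx A (z *: G))) (row_mx 0 y).
  have [p3 [C [hC eC _]]] := linres_unfold (linres_irrel p2 lirr); move=> /eC [w <-].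
  rewrite -(mulmx0 _ w) -mul_mx_row; apply: submod_mulmx => // i; rewrite row_row_mx row0.
  have [y' hy' <-] := quotient_lift_homog hphi (mhomog_row i hC).
  have hzy : z *: (y' *m G) = y' *m (z *: G) by rewrite -scalemxAr.
  apply: syzygy_right; apply/eB; apply: colon.
    by apply: scale_z_homog; rewrite hzy; apply: (mhomogM (d := 1)).
  by rewrite hzy; apply: submod_mulmx.
have SE := syzygy_image hB indep left right.
apply: (linres_fold hB eB); apply: (linres_lift hphi hz z0).
- exact: graded_rker hB.
- exact: saturated_rker.
- apply: linres_ext (linres_dsum kBb (linres_irrel p2 lirr)) => u.
  by rewrite SE AB.
Qed.

End Transfer.

(** * Graded ideals *)

Section GradedIdeals.
Variables (K : fieldType) (n : nat).
Local Notation R := {mpoly K[n]}.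
Implicit Types (I J S : R -> Prop) (f g : R).

Lemma ideal_sum I (T : finType) (F : T -> R) :
  is_ideal I -> (forall i, I (F i)) -> I (\sum_i F i).
Proof. by case=> h0 hD _ h; apply: big_ind. Qed.

Lemma ideal_comps I f : is_ideal I -> (forall d, I (hcomp d f)) -> I f.
Proof.
by move=> iI h; rewrite (@pihomog_partitionE _ _ mdeg _ f (leqnn _)); apply: ideal_sum.
Qed.

Lemma mem_ideal_gen S f : S f -> ideal_gen S f.
Proof.
by move=> hf; exists 1%N, (fun=> 1), (fun=> f); split=> //; rewrite big_ord1 mul1r.
Qed.

Lemma is_ideal_gen S : is_ideal (ideal_gen S).
Proof.
split.
- by exists 0%N, (fun=> 0), (fun=> 0); split=> [[]|] //; rewrite big_ord0.
- move=> _ _ [k [c [g [hg ->]]]] [k' [c' [g' [hg' ->]]]].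
  exists (k + k')%N, (fun i => match split i with inl j => c j | inr j => c' j end).
  exists (fun i => match split i with inl j => g j | inr j => g' j end); split.
    by move=> i; case: split.
  rewrite big_split_ord /=; congr (_ + _); apply: eq_bigr => i _.
    by rewrite (unsplitK (inl _ i)).
  by rewrite (unsplitK (inr _ i)).
- move=> f _ [k [c [g [hg ->]]]]; exists k, (fun i => f * c i), g; split=> //.
  by rewrite mulr_sumr; apply: eq_bigr => i _; rewrite mulrA.
Qed.

Lemma ideal_gen_min S J f : is_ideal J -> (forall g, S g -> J g) -> ideal_gen S f -> J f.
Proof.
move=> iJ SJ [k [c [g [hg ->]]]]; apply: ideal_sum => // i.
by case: iJ => _ _; apply; apply: SJ.
Qed.

Lemma degree_part_sub I d f : is_ideal I -> ideal_degree_part I d f -> I f.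
Proof. by move=> iI; apply: ideal_gen_min => // g []. Qed.

Lemma mem_degree_part I d f : I f -> f \is d.-homog -> ideal_degree_part I d f.
Proof. by move=> *; apply: mem_ideal_gen. Qed.

Lemma is_ideal_degree_part I d : is_ideal (ideal_degree_part I d).
Proof. exact: is_ideal_gen. Qed.

(** Taking components of the coefficients makes a representation homogeneous. *)
Lemma degree_part_rep I d e f : ideal_degree_part I d f ->
  hcomp (e + d) f = 0 \/ exists k (c g : 'I_k -> R),
    [/\ forall i, c i \is e.-homog, forall i, I (g i) /\ g i \is d.-homog
      & hcomp (e + d) f = \sum_i c i * g i].
Proof.
move=> [k [c [g [hg ->]]]]; right; exists k, (fun i => hcomp e (c i)), g; split=> // [i|].
  exact: pihomogP.
by rewrite linear_sum; apply: eq_bigr => i _ /=; rewrite hcompM //; case: (hg i).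
Qed.

Lemma degree_part_low I d e f : ideal_degree_part I d f -> (e < d)%N -> hcomp e f = 0.
Proof.
move=> [k [c [g [hg ->]]]] ed; rewrite linear_sum big1 // => i _ /=.
by rewrite (hcompM_low _ _ ed) //; case: (hg i).
Qed.

Lemma graded_degree_part I d : is_graded_ideal (ideal_degree_part I d).
Proof.
split=> [|f e hf]; first exact: is_ideal_degree_part.
have [_ _ hM] := is_ideal_degree_part I d.
have [le|lt] := leqP d e; last by rewrite (degree_part_low hf lt); case: (is_ideal_degree_part I d).
have := degree_part_rep (e - d) hf; rewrite subnK // => -[->|[k [c [g [_ hg ->]]]]].
  by case: (is_ideal_degree_part I d).
by apply: ideal_sum (is_ideal_degree_part I d) _ => i; apply/hM/mem_ideal_gen.
Qed.

(** Degree is moved from the coefficients to the generators one variable at a time; [t] in [mul]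
    counts the variables moved. *)
Lemma degree_part_le I d d' e f : is_ideal I -> ideal_degree_part I d f ->
  f \is e.-homog -> (d <= d' <= e)%N -> ideal_degree_part I d' f.
Proof.
move=> iI hf he /andP[le1 le2].
have mul t : forall k c d0 g, (t <= k)%N -> c \is k.-homog -> I g -> g \is d0.-homog ->
    ideal_degree_part I (t + d0) (c * g).
  have [_ _ IM] := iI; elim: t => [|t IH] k c d0 g tk hc Ig hg.
    by have [_ _] := is_ideal_degree_part I d0; apply; apply: mem_degree_part.
  case: k tk hc => // k tk /dhomogS [b hb ->]; rewrite mulr_suml.
  apply: ideal_sum => [|i]; first exact: is_ideal_degree_part.
  rewrite -mulrA mulrCA addSnnS; apply: (IH k) => //; first exact: IM.
  by rewrite -add1n; apply: dhomogM => //; apply: dhomogXi.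
rewrite -(pihomog_dE he) -(subnK (leq_trans le1 le2)).
case: (degree_part_rep (e - d) hf) => [->|[k [c [g [hc hg ->]]]]].
  by case: (is_ideal_degree_part I d').
apply: ideal_sum => [|i]; first exact: is_ideal_degree_part.
rewrite -(subnK le1); have [Ig hgi] := hg i; exact: mul (leq_sub2r d le2) (hc i) Ig hgi.
Qed.

Definition row_ideal J : 'rV[R]_1 -> Prop := fun v => J (v 0 0).

Lemma mhomog_scalar d f : f \is d.-homog -> mhomog d (f%:M : 'M_1).
Proof. by move=> hf i j; rewrite !ord1 mxE. Qed.

Lemma graded_row_ideal J : is_graded_ideal J -> graded_submod (row_ideal J).
Proof.
move=> [[J0 JD JM] Jg]; split=> [|v d Jv]; last by rewrite /row_ideal mxE; apply: Jg.
split=> [|u v Ju Jv|c v Jv]; rewrite /row_ideal mxE //; first exact: JD.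
exact: JM.
Qed.

Lemma generated_row_degree_part I d :
  generated_in_degree d (row_ideal (ideal_degree_part I d)).
Proof.
move=> M [M0 MD MZ] h v hv.
rewrite [v]mx11_scalar; move: hv; rewrite /row_ideal; move: (v 0 0) => f.
apply: (ideal_gen_min (J := fun f => M (f%:M : 'rV_1))).
  split=> [|f1 f2 h1 h2|f1 f2 h2]; first by rewrite raddf0.
    by rewrite raddfD; apply: MD.
  by rewrite -scale_scalar_mx; apply: MZ.
move=> g [Ig hg]; apply: h; last exact: mhomog_scalar.
by rewrite /row_ideal mxE; apply: mem_degree_part.
Qed.

(** The prescribed degrees amount to entries of degree 1 in all differentials. Such entries lie in
    the maximal ideal, so minimality is automatic. *)
Lemma linear_resolutionP J d : has_linear_resolution J d <-> linres d (row_ideal J).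
Proof.
split=> [[F [_ deg]]|[rk [A [D [hA hD eA ex0 ex]]]]].
  exists (rk F), (aug F), (@diff _ _ _ F); split.
  - by move=> k j; rewrite ord1; have := aug_homog k; rewrite deg.
  - move=> i k l; case: (diff_homog k l) => [->|[e]]; first exact: rpred0.
    by rewrite !deg => e1; have -> : e = 1%N by lia.
  - move=> v; rewrite /row_ideal (aug_image F); split=> [[w wE]|[w <-]]; exists w => //.
    by apply/matrixP => i j; rewrite !ord1.
  - exact: aug_exact.
  - exact: diff_exact.
pose bd i (k : 'I_(rk i)) := (i + d)%N.
have h1 : forall k, A k 0 \is (bd 0 k).-homog by move=> k; apply: hA.
have h2 : forall i k l, D i k l = 0 \/
    exists2 e, (e + bd i l)%N = bd i.+1 k & D i k l \is e.-homog.
  by move=> i k l; right; exists 1%N => //; apply: hD.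
have h3 f : J f <-> exists v : 'rV[R]_(rk 0), (v *m A) 0 0 = f.
  have -> : J f <-> row_ideal J f%:M by rewrite /row_ideal mxE.
  rewrite eA; split=> -[w wE]; exists w; first by rewrite wE mxE.
  by apply/matrixP => i j; rewrite !ord1 wE mxE.
exists (GradedFreeResolution h1 h2 h3 ex0 ex); split=> // i k l /=.
have [g hg ->] := dhomogS (hD i k l); exists n, g, (fun i => 'X_i); split=> [j|].
  by exists j.
by apply: eq_bigr => j _; rewrite mulrC.
Qed.

End GradedIdeals.

Lemma ideal_imageM (K : fieldType) m n (phi : {lrmorphism {mpoly K[m]} -> {mpoly K[n]}}) I :
  (forall g, exists f, phi f = g) -> is_ideal I -> is_ideal (ideal_image phi I).
Proof.
move=> surj [I0 ID IM]; split.
- by exists 0; rewrite ?rmorph0.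
- move=> _ _ [f If <-] [g Ig <-]; exists (f + g); first exact: ID.
  by rewrite rmorphD.
- move=> f _ [g Ig <-]; have [f' <-] := surj f; exists (f' * g); first exact: IM.
  by rewrite rmorphM.
Qed.

(** * Images of graded ideals modulo a linear form *)

Section IdealImages.
Variables (K : fieldType) (n : nat) (z : {mpoly K[n.+1]}).
Variable phi : {lrmorphism {mpoly K[n.+1]} -> {mpoly K[n]}}.
Hypothesis hphi : is_quotient_by z phi.

Lemma graded_ideal_image I : is_graded_ideal I -> is_graded_ideal (ideal_image phi I).
Proof.
move=> [iI gI]; split; first by case: hphi => _ surj _; apply: ideal_imageM.
move=> _ d [f If <-]; exists (hcomp d f); first exact: gI.
exact: quotient_hcomp hphi d f.
Qed.

(** A degree [d] form of the image lifts to the degree [d] component of a preimage in [I]. *)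
Lemma ideal_image_degree_part I d : is_graded_ideal I ->
  ideal_eq (ideal_image phi (ideal_degree_part I d)) (ideal_degree_part (ideal_image phi I) d).
Proof.
have [_ surj _] := hphi => -[iI gI] f; split=> [[g hg <-]|].
  apply: (ideal_gen_min (J := fun g => ideal_degree_part (ideal_image phi I) d (phi g))) (hg)
    => [|h [Ih hh]]; last first.
    by apply: (mem_degree_part (f := phi h)); [exists h | exact (quotient_homog hphi hh)].
  have [D0 DD DM] := is_ideal_degree_part (ideal_image phi I) d.
  split=> [|f1 f2|f1 f2]; first by rewrite rmorph0.
    by rewrite rmorphD; apply: DD.
  by rewrite rmorphM; apply: DM.
apply: ideal_gen_min; first by apply: ideal_imageM => //; apply: is_ideal_degree_part.
move=> _ [[h Ih <-] hh]; exists (hcomp d h).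
  by apply: mem_degree_part; [apply: gI | apply: pihomogP].
by rewrite (quotient_hcomp hphi) pihomog_dE.
Qed.

Lemma mimage_row_ideal J v : mimage phi (row_ideal J) v <-> row_ideal (ideal_image phi J) v.
Proof.
split=> [[w Jw <-]|[f Jf fE]]; first by exists (w 0 0); rewrite ?mxE.
exists f%:M; first by rewrite /row_ideal mxE.
by apply/matrixP => i j; rewrite !ord1 !mxE.
Qed.
End IdealImages.

(** Makes the linearity of the maximal ideal an instance of that of its powers. *)
Lemma irrelP (K : fieldType) n (v : 'rV[{mpoly K[n]}]_1) :
  row_ideal (ideal_degree_part (fun=> True) 1) v <-> irrel v.
Proof.
rewrite /irrel; split=> [h|/matrixP /(_ 0 0)].
  by apply/matrixP => i j; rewrite !ord1 !mxE; apply: degree_part_low h _.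
rewrite !mxE => h; apply: ideal_comps => [|e]; first exact: is_ideal_degree_part.
case: e => [|e]; first by rewrite h; case: (is_ideal_degree_part (fun _ : {mpoly K[n]} => True) 1).
apply: (degree_part_le (d := 0) (e := e.+1)) => //; last exact: pihomogP.
have [_ _] := is_ideal_degree_part (fun _ : {mpoly K[n]} => True) 0.
by rewrite -[hcomp _ _]mulr1; apply; apply: mem_degree_part => //; apply: dhomog1.
Qed.

(** These ideals are the powers of the maximal ideal. The colon condition is trivial for the unit
    ideal; induction on the number of variables supplies both the image and the linear maximal ideal
    that [linres_of_quotient] asks for. *)
Lemma linres_unit_degree_part (K : fieldType) n d :
  linres d (row_ideal (ideal_degree_part (fun _ : {mpoly K[n]} => True) d)).
Proof.
elim: n d => [|n IH] d.
  case: d => [|d].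
    apply: (linres_fold (A := 1%:M : 'M[{mpoly K[0]}]_1)).
    - by apply: mhomog_scalar; apply: dhomog1.
    - move=> v; split=> _; first by exists v; rewrite mulmx1.
      by apply: mem_degree_part => //; apply: nvar0_homog.
    - by apply: linres_zero => v; rewrite /rker mulmx1.
  apply: linres_zero => v; split=> [|->]; last first.
    by rewrite /row_ideal mxE; case: (is_ideal_degree_part (fun _ : {mpoly K[0]} => True) d.+1).
  move=> /degree_part_low /(_ (ltn0Sn d)); rewrite pihomog_dE; last exact: nvar0_homog.
  by move=> v0; apply/matrixP => i j; rewrite !ord1 mxE.
have hz : ('X_ord0 : {mpoly K[n.+1]}) \is 1.-homog by exact: dhomogXi.
have z0 : ('X_ord0 : {mpoly K[n.+1]}) != 0 by rewrite -msize_poly_eq0 msizeX.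
have [phi hphi] := exists_quotient hz z0.
apply: (linres_of_quotient hphi hz z0).
- exact/graded_row_ideal/graded_degree_part.
- exact: generated_row_degree_part.
- by move=> v hv _; apply: mem_degree_part.
- apply: linres_ext (IH d) => v; rewrite (mimage_row_ideal phi).
  rewrite /row_ideal; have -> := ideal_image_degree_part hphi d _ (v 0 0); last by split.
  have [_ surj _] := hphi.
  split; apply: ideal_gen_min; try exact: is_ideal_degree_part;
    move=> g [_ hg]; apply: mem_degree_part => //.
  by have [f <-] := surj g; exists f.
- exact: linres_ext (@irrelP K n) (IH 1%N).
Qed.

(** * Noetherianity and general linear forms *)

(** Each index is chosen so that [u] is minimal there among all later indices. *)
Lemma nondecreasing_subsequence (u : nat -> nat) :
  exists g : nat -> nat, (forall i, g i < g i.+1)%N /\ (forall i, u (g i) <= u (g i.+1))%N.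
Proof.
have min k : exists m, (k <= m)%N /\ forall j, (k <= j)%N -> (u m <= u j)%N.
  suff H x : forall m, (k <= m)%N -> (u m <= x)%N -> exists m', (k <= m')%N /\
      forall j, (k <= j)%N -> (u m' <= u j)%N by exact: (H (u k) k).
  elim: x => [|x IH] m km ux.
    by exists m; split=> // j _; move: ux; rewrite leqn0 => /eqP->.
  case: (classic (exists2 j, (k <= j)%N & (u j <= x)%N)) => [[j kj jx]|no]; first exact: IH jx.
  exists m; split=> // j kj; apply: leq_trans ux _; rewrite ltnNge.
  by apply/negP => jx; apply: no; exists j.
pose pick k := sval (constructive_indefinite_description _ (min k)).
have pickP k : (k <= pick k)%N /\ forall j, (k <= j)%N -> (u (pick k) <= u j)%N.
  by rewrite /pick; case: constructive_indefinite_description.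
pose g i := iter i (fun m => pick m.+1) (pick 0%N).
exists g; split=> i; first exact: (pickP (g i).+1).1.
have [k gk] : exists k, g i = pick k by case: i => [|i]; [exists 0%N | exists (g i).+1].
rewrite {1}gk; apply: (pickP k).2; apply: leq_trans (pickP k).1 _.
rewrite -gk; exact: leq_trans (leqnSn _) (pickP (g i).+1).1.
Qed.

(** Subsequences are refined one coordinate at a time; [k] counts the coordinates already
    nondecreasing. *)
Lemma dickson n (u : nat -> 'X_{1..n}) : exists i j, (i < j)%N /\ (u i <= u j)%MM.
Proof.
suff H k : exists g : nat -> nat, (forall i, g i < g i.+1)%N /\
    forall (c : 'I_n) i, (c < k)%N -> (u (g i) c <= u (g i.+1) c)%N.
  have [g [gi gc]] := H n; exists (g 0%N), (g 1%N); split=> //.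
  by apply/mnm_lepP => c; apply: gc.
elim: k => [|k [g [gi gc]]]; first by exists id.
have [kn|nk] := ltnP k n; last first.
  by exists g; split=> // c i _; apply: gc; apply: leq_trans nk.
have [h [hi hc]] := nondecreasing_subsequence (fun i => u (g i) (Ordinal kn)).
have homo (c : 'I_n) i j : (c < k)%N -> (i <= j)%N -> (u (g i) c <= u (g j) c)%N.
  move=> ck; apply: (homo_leq (f := fun i => u (g i) c) (r := leq)) => //.
    exact: leq_trans.
  by move=> m; apply: gc.
exists (g \o h); split=> [i|c i].
  by apply: (homo_ltn ltn_trans gi).
rewrite ltnS leq_eqVlt => /orP[/eqP ck|ck]; last by apply: homo => //; apply/ltnW/hi.
have -> : c = Ordinal kn by apply: val_inj.
exact: hc.
Qed.

Section Noetherian.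
Variables (K : fieldType) (n : nat).
Local Notation R := {mpoly K[n]}.
Implicit Types (I J : R -> Prop).

(** Hilbert's basis theorem: each step gets a new element with smallest leading monomial. By
    Dickson's lemma one of these monomials divides a later one, and cancelling the later leading
    term gives a smaller new element. *)
Lemma ideal_chain_not_strict (J : nat -> R -> Prop) :
  (forall k, is_ideal (J k)) -> (forall k f, J k f -> J k.+1 f) ->
  (forall k, exists f, J k.+1 f /\ ~ J k f) -> False.
Proof.
move=> iJ inc strict.
have minlead k : exists f, [/\ J k.+1 f, ~ J k f &
    forall g, J k.+1 g -> ~ J k g -> ~~ (mlead g < mlead f)%O].
  have [f [f1 f2]] := strict k; move: f1 f2.
  elim/mleadrect: f => f IH f1 f2.
  case: (classic (exists g, [/\ J k.+1 g, ~ J k g & (mlead g < mlead f)%O])) => [[g [g1 g2 lt]]|no].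
    exact: IH lt g1 g2.
  by exists f; split=> // g g1 g2; apply/negP => lt; apply: no; exists g.
pose f k := sval (constructive_indefinite_description _ (minlead k)).
have fP k : [/\ J k.+1 (f k), ~ J k (f k) &
    forall g, J k.+1 g -> ~ J k g -> ~~ (mlead g < mlead (f k))%O].
  by rewrite /f; case: constructive_indefinite_description.
have f0 k : f k != 0.
  by apply/eqP => e; have [_] := fP k; rewrite e; have [J0 _ _] := iJ k.
have [i [j [ij le]]] := dickson (fun k => mlead (f k)).
have [fi _ _] := fP i; have [fj nfj fmin] := fP j.
have lci : mleadc (f i) != 0 by rewrite mleadc_eq0.
have lcj : mleadc (f j) != 0 by rewrite mleadc_eq0.
pose c := mleadc (f j) / mleadc (f i).
have c0 : c != 0 by rewrite mulf_neq0 ?invr_eq0.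
(* [h] is the multiple of [f i] with the leading term of [f j]; it lies in [J j] because [i < j]. *)
pose h := c *: (f i * 'X_[mlead (f j) - mlead (f i)]).
have X0 : 'X_[mlead (f j) - mlead (f i)] != 0 :> R by rewrite -msize_poly_eq0 msizeX.
have leadh : mlead h = mlead (f j).
  by rewrite mleadZ // mleadM // mleadXm addmC submK.
have lch : h@_(mlead (f j)) = mleadc (f j).
  by rewrite mcoeffZ -{1}(submK le) mcoeffMX /c divfK.
have Jh : J j h.
  have [_ _ JM] := iJ j; rewrite /h -mul_mpolyC; apply: (JM); rewrite mulrC; apply: (JM).
  have {ij}: (i.+1 <= j)%N by [].
  elim: (j) => [|m IH]; first by [].
  rewrite leq_eqVlt => /orP[/eqP<- //|lt]; apply: inc; exact: IH.
have [_ JD JM] := iJ j.+1.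
have hJ1 : J j.+1 (f j - h).
  by apply: JD => //; rewrite -mulN1r; apply: JM; apply: inc.
have hJ2 : ~ J j (f j - h).
  by move=> e; apply: nfj; rewrite -(subrK h (f j)); have [_ JDj _] := iJ j; apply: JDj.
have /negP := fmin _ hJ1 hJ2; apply.
have nz : f j - h != 0.
  by apply/eqP => e; apply: hJ2; rewrite e; have [] := iJ j.
rewrite lt_neqAle; apply/andP; split.
  apply: contra nz => /eqP e; rewrite -mleadc_eq0 e mcoeffB lch subrr //.
by have := mleadB_le (f j) h; rewrite leadh joinxx.
Qed.

(** A failure would give, by choice, a strictly increasing chain of counterexamples. *)
Lemma noetherian_ind (P : (R -> Prop) -> Prop) :
  (forall J, is_ideal J ->
     (forall J', is_ideal J' -> (forall f, J f -> J' f) -> (exists f, J' f /\ ~ J f) -> P J') ->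
   P J) ->
  forall J, is_ideal J -> P J.
Proof.
move=> step J0 iJ0; apply: NNPP => nP.
pose bad := {J : R -> Prop | is_ideal J /\ ~ P J}.
have next (x : bad) : {y : bad | (forall f, sval x f -> sval y f) /\
    exists f, sval y f /\ ~ sval x f}.
  apply: constructive_indefinite_description; case: x => J [iJ nJ] /=.
  apply: NNPP => no; apply: nJ; apply: step => // J' iJ' sub strict.
  apply: NNPP => nJ'; apply: no.
  by exists (exist _ J' (conj iJ' nJ')).
pose x k := iter k (fun y => sval (next y)) (exist _ J0 (conj iJ0 nP) : bad).
apply: (ideal_chain_not_strict (J := fun k => sval (x k))) => k.
- by case: (x k) => ? [].
- exact: (svalP (next (x k))).1.
- exact: (svalP (next (x k))).2.
Qed.

(** Noetherian induction on the ideal generated by the forms of [I] of degree at most [D]: if some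
    [f] of [I] is missing, the bound is raised to cover all its components. *)
Lemma generated_in_bounded_degree I : is_graded_ideal I ->
  exists D, forall d f, (D <= d)%N -> I f -> f \is d.-homog -> ideal_degree_part I D f.
Proof.
move=> [iI gI].
pose S D f := I f /\ exists2 e, (e <= D)%N & f \is e.-homog.
suff H : forall J, is_ideal J -> forall D, (forall f, J f <-> ideal_gen (S D) f) ->
    exists D', forall f, I f -> ideal_gen (S D') f.
  have [D hD] := H _ (is_ideal_gen (S 0%N)) 0%N (fun f => iff_refl _).
  exists D => d f Dd If hf; have [k [c [g [hg fE]]]] := hD f If.
  rewrite -(pihomog_dE hf) fE linear_sum.
  apply: ideal_sum => [|i /=]; first exact: is_ideal_degree_part.
  have [Ig [e eD he]] := hg i.
  apply: (degree_part_le (d := e) (e := d)) => //; last 2 first.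
  - exact: pihomogP.
  - by rewrite eD.
  apply: (graded_degree_part I e).2.
  by have [_ _ hM] := is_ideal_degree_part I e; apply/hM/mem_degree_part.
apply: noetherian_ind => J iJ IH D JE.
case: (classic (forall f, I f -> ideal_gen (S D) f)) => [h|/not_all_ex_not [f nf]]; first by exists D.
have [If nSf] := imply_to_and _ _ nf.
pose D' := maxn D (mmeasure mdeg f).
apply: (IH (ideal_gen (S D')) (is_ideal_gen _) _ _ D') => //.
  move=> g /JE; apply: ideal_gen_min; first exact: is_ideal_gen.
  move=> h [Ih [e eD he]]; apply: mem_ideal_gen; split=> //; exists e => //.
  by rewrite leq_max eD.
exists f; split; last by rewrite JE.
rewrite (@pihomog_partitionE _ _ mdeg _ f (leqnn _)); apply: ideal_sum => [|e].
  exact: is_ideal_gen.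
apply: mem_ideal_gen; split; first exact: gI.
by exists e; [rewrite leq_max (ltnW (ltn_ord e)) orbT | apply: pihomogP].
Qed.
End Noetherian.

(** * Generic linear forms and saturation *)

Section Genericity.
Variables (K : fieldType) (hK : infinite_field K) (n : nat).
Local Notation R := {mpoly K[n]}.
Implicit Types (J : R -> Prop) (U V : ('I_n -> K) -> Prop).

Lemma infinite_uniq k : exists2 s : seq K, uniq s & size s = k.
Proof.
elim: k => [|k [s us <-]]; first by exists [::].
by have [x xs] := hK s; exists (x :: s); rewrite //= xs.
Qed.

Lemma nonroot (p : {poly K}) : p != 0 -> exists t, p.[t] != 0.
Proof.
move=> p0; have [s us ss] := infinite_uniq (size p).
case: (boolP (all (root p) s)) => [h|/allPn [t _ nt]]; last by exists t.
by have := max_poly_roots p0 h us; rewrite ss ltnn.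
Qed.

Lemma restrict_to_line (a b : 'I_n -> K) (p : R) : exists q : {poly K},
  forall t, q.[t] = p.@[fun i => a i + (b i - a i) * t].
Proof.
elim/mpoly_gen_ind: p => [c|p q [p' pE] [q' qE]|p q [p' pE] [q' qE]|i].
- by exists c%:P => t; rewrite hornerC mevalC.
- by exists (p' + q') => t; rewrite hornerD mevalD pE qE.
- by exists (p' * q') => t; rewrite hornerM mevalM pE qE.
- by exists ((a i)%:P + (b i - a i)%:P * 'X) => t; rewrite mevalXU !hornerE.
Qed.

Definition generic U := zariski_open U /\ exists a, U a.

(** On the line through a point of each open set, both polynomials restrict to nonzero ones; over an
    infinite field their product is nonzero at some point. *)
Lemma generic_and U V : generic U -> generic V -> generic (fun a => U a /\ V a).
Proof.
move=> [[S US] [a /US [p Sp pa]]] [[T VT] [b /VT [q Tq qb]]]; split.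
  exists (fun f => exists p q, [/\ S p, T q & f = p * q]) => c; split.
    move=> [/US [p' Sp' pc] /VT [q' Tq' qc]]; exists (p' * q'); first by exists p', q'.
    by rewrite mevalM mulf_neq0.
  move=> [_ [p' [q' [Sp' Tq' ->]]]]; rewrite mevalM mulf_eq0 negb_or => /andP[pc qc].
  by split; [apply/US; exists p' | apply/VT; exists q'].
have [p' pE] := restrict_to_line a b p; have [q' qE] := restrict_to_line a b q.
have p'0 : p' != 0.
  apply: contraNneq pa => p0; have := pE 0; rewrite p0 horner0 => /esym/eqP.
  by rewrite (@meval_eq _ _ _ a) // => i; rewrite mulr0 addr0.
have q'0 : q' != 0.
  apply: contraNneq qb => q0; have := qE 1; rewrite q0 horner0 => /esym/eqP.
  by rewrite (@meval_eq _ _ _ b) // => i; rewrite mulr1 addrC subrK.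
have [t] := nonroot (mulf_neq0 p'0 q'0); rewrite hornerM pE qE mulf_eq0 negb_or => /andP[pt qt].
by exists (fun i => a i + (b i - a i) * t); split; [apply/US; exists p|apply/VT; exists q].
Qed.

Lemma generic_all (V : nat -> ('I_n -> K) -> Prop) D : (forall d, generic (V d)) ->
  generic (fun a => forall d, (d < D)%N -> V d a).
Proof.
move=> gV; elim: D => [|D [[S VS] ne]].
  split; last by exists (fun=> 0).
  by exists (fun=> True) => a; split=> // _; exists 1 => //; rewrite meval1 oner_neq0.
have [[T VT] ne'] := generic_and (conj (ex_intro _ S VS) ne) (gV D).
have e a : (forall d, (d < D.+1)%N -> V d a) <-> ((forall d, (d < D)%N -> V d a) /\ V D a).
  split=> [h|[h hD] d]; first by split=> [d lt|]; apply: h => //; apply: ltnW.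
  by rewrite ltnS leq_eqVlt => /orP[/eqP->|] //; apply: h.
split; first by exists T => a; rewrite e.
by have [a ha] := ne'; exists a; rewrite e.
Qed.

Lemma linear_form_coef (a : 'I_n -> K) i : (linear_form a)@_U_(i) = a i.
Proof.
rewrite raddf_sum (bigD1 i) //= big1 ?addr0 => [|j ne].
  by rewrite mcoeffZ mcoeffX eqxx mulr1.
rewrite mcoeffZ mcoeffX; case: eqP => [/mnmP /(_ i)|]; last by rewrite mulr0.
by rewrite !mnm1E eqxx (negPf ne).
Qed.

(** The linear forms in [J] are a subspace, and the columns of its cokernel matrix are linear
    equations for it. *)
Lemma generic_notin J (a : 'I_n -> K) : is_ideal J -> ~ J (linear_form a) ->
  generic (fun a => ~ J (linear_form a)).
Proof.
move=> [J0 JD JM] na; split; last by exists a.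
have sW : subspace (fun r : 'rV[K]_n => J (linear_form (fun i => r 0 i))).
  split=> [|u v hu hv|c v hv].
  - by rewrite /linear_form big1 // => i _; rewrite mxE scale0r.
  - have -> : linear_form (fun i => (u + v) 0 i) =
        linear_form (fun i => u 0 i) + linear_form (fun i => v 0 i).
      by rewrite -big_split; apply: eq_bigr => i _; rewrite mxE scalerDl.
    exact: JD.
  - have -> : linear_form (fun i => (c *: v) 0 i) = c%:MP * linear_form (fun i => v 0 i).
      by rewrite mulr_sumr; apply: eq_bigr => i _; rewrite mxE mul_mpolyC scalerA.
    exact: JM.
have [M WM] := subspace_mx sW.
exists (fun p => exists j, p = \sum_i cokermx M i j *: 'X_i) => b.
pose r : 'rV[K]_n := \row_i b i.
have ev j : (\sum_i cokermx M i j *: 'X_i : R).@[b] = (r *m cokermx M) 0 j.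
  rewrite mxE raddf_sum; apply: eq_bigr => i _.
  by rewrite [LHS]mevalZ mevalXU [r 0 i]mxE mulrC.
have Jr : J (linear_form b) <-> r *m cokermx M = 0.
  have -> : linear_form b = linear_form (fun i => r 0 i).
    by apply: eq_bigr => i _; rewrite mxE.
  by rewrite WM submxE; split=> /eqP.
rewrite Jr; split=> [nz|[_ [j ->]]]; last by rewrite ev => /eqP nz e; apply: nz; rewrite e mxE.
have /existsP [j nj] : [exists j, (r *m cokermx M) 0 j != 0].
  apply: contra_notT nz; rewrite negb_exists => /forallP h.
  by apply/rowP => j; rewrite [RHS]mxE; apply/eqP/negPn.
by exists (\sum_i cokermx M i j *: 'X_i); [exists j | rewrite ev].
Qed.

(* Some power of the irrelevant ideal multiplies [f] into [J]. *)
Inductive in_saturation J : R -> Prop :=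
| in_saturation_mem f : J f -> in_saturation J f
| in_saturation_step f : (forall i, in_saturation J ('X_i * f)) -> in_saturation J f.

Lemma in_saturationM J f g : is_ideal J -> in_saturation J f -> in_saturation J (g * f).
Proof.
move=> [_ _ JM] h; elim: h g => {f} [f Jf|f _ IH] g; first exact/in_saturation_mem/JM.
by apply: in_saturation_step => i; rewrite mulrCA.
Qed.

Lemma in_saturationD J f g :
  is_ideal J -> in_saturation J f -> in_saturation J g -> in_saturation J (f + g).
Proof.
move=> iJ h; elim: h g => {f} [f Jf|f _ IH] g hg.
  elim: hg f Jf => {g} [g Jg|g _ IH] f Jf.
    by apply: in_saturation_mem; case: iJ => _ + _; apply.
  by apply: in_saturation_step => i; rewrite mulrDr; apply: IH; case: iJ => _ _; apply.
by apply: in_saturation_step => i; rewrite mulrDr; apply/IH/in_saturationM.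
Qed.

(* Noetherian induction: if f g lies in J but f and g do not, the claim for J
   follows from those for J : f and J + (f). *)
Lemma generic_filter_regular J : is_ideal J -> exists U, generic U /\
  forall a f, U a -> J (linear_form a * f) -> in_saturation J f.
Proof.
apply: (@noetherian_ind K n (fun J => exists U, generic U /\
  forall a f, U a -> J (linear_form a * f) -> in_saturation J f)) => {}J iJ IH.
have [J0 JD JM] := iJ.
case: (classic (exists f g, [/\ J (f * g), ~ J f & ~ J g])) => [[f [g [Jfg nf ng]]]|prime].
  (* The ideal [J : f] gains [g] and [J + (f)] gains [f], so the induction hypothesis covers
     both. *)
  have iC : is_ideal (fun h => J (f * h)).
    split=> [|h1 h2 j1 j2|h1 h2 j2]; first by rewrite mulr0.
      by rewrite mulrDr; apply: JD.
    by rewrite mulrCA; apply: JM.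
  have iS : is_ideal (fun h => exists j c, J j /\ h = j + c * f).
    split=> [|_ _ [j1 [c1 [h1 ->]]] [j2 [c2 [h2 ->]]]|h _ [j [c [h1 ->]]]].
    - by exists 0, 0; rewrite mul0r addr0.
    - by exists (j1 + j2), (c1 + c2); rewrite mulrDl addrACA; split=> //; apply: JD.
    - by exists (h * j), (h * c); rewrite mulrDr mulrA; split=> //; apply: JM.
  have [h Jh||U1 [gU1 hU1]] := IH _ iC; [exact: JM | by exists g | ].
  have [h Jh||U2 [gU2 hU2]] := IH _ iS.
  - by exists h, 0; rewrite mul0r addr0.
  - by exists f; split=> //; exists 0, 1; rewrite mul1r add0r.
  exists (fun a => U1 a /\ U2 a); split; first exact: generic_and.
  move=> a h [Ua1 Ua2] Jah.
  have : in_saturation (fun h => exists j c, J j /\ h = j + c * f) h.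
    by apply: hU2 Ua2 _; exists (linear_form a * h), 0; rewrite mul0r addr0.
  (* After multiplication by variables [h] is [j + c * f]. The form times [c] then lies in [J : f],
     so [c] is in the saturation of [J : f] and [c * f] in that of [J]. *)
  move=> sh; elim: sh Jah => {h} [_ [j [c [Jj ->]]]|h _ IHh] Jah; last first.
    by apply: in_saturation_step => i; apply: IHh; rewrite mulrCA; apply: JM.
  apply: in_saturationD => //; first exact: in_saturation_mem.
  have sc : in_saturation (fun h => J (f * h)) c.
    apply: hU1 Ua1 _; rewrite mulrCA (mulrC f).
    have -> : linear_form a * (c * f) = linear_form a * (j + c * f) + (- linear_form a) * j.
      by rewrite mulrDr mulNr addrAC subrr add0r.
    by apply: JD => //; apply: JM.
  elim: sc => {c Jah} [c Jc|c _ IHc]; first by apply: in_saturation_mem; rewrite mulrC.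
  by apply: in_saturation_step => i; rewrite mulrA.
(* Now [J] is prime or the unit ideal, so any linear form outside [J] is a nonzerodivisor modulo
   [J]. *)
case: (classic (exists a, ~ J (linear_form a))) => [[a na]|no].
  exists (fun a => ~ J (linear_form a)); split; first exact: generic_notin na.
  move=> b f nb Jbf; apply: in_saturation_mem; apply: NNPP => nf.
  by apply: prime; exists (linear_form b), f.
(* Here all variables lie in [J], and its saturation is the whole ring. *)
exists (fun=> True); split.
  split; last by exists (fun=> 0).
  by exists (fun=> True) => a; split=> // _; exists 1 => //; rewrite meval1 oner_neq0.
move=> a f _ _; apply: in_saturation_step => i; apply: in_saturation_mem.
have Ji : J (linear_form (fun j => (j == i)%:R)).
  by apply: NNPP => h; apply: no; eexists; exact: h.
rewrite mulrC; apply: JM; move: Ji; rewrite /linear_form (bigD1 i) //= eqxx scale1r big1 ?addr0 //.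
by move=> j /negPf ->; rewrite scale0r.
Qed.

End Genericity.

(** * Completely m-full ideals *)

Lemma graded_ideal_ext (K : fieldType) n (I J : {mpoly K[n]} -> Prop) :
  ideal_eq I J -> is_graded_ideal I -> is_graded_ideal J.
Proof.
move=> e [[I0 ID IM] gI]; split; first split; rewrite -?e //.
- by move=> f g /e If /e Ig; apply/e/ID.
- by move=> f g /e Ig; apply/e/IM.
- by move=> f d /e If; apply/e/gI.
Qed.

Lemma degree_part_ext (K : fieldType) n (I J : {mpoly K[n]} -> Prop) d :
  ideal_eq I J -> ideal_eq (ideal_degree_part I d) (ideal_degree_part J d).
Proof.
by move=> e f; split; apply: ideal_gen_min; try exact: is_ideal_degree_part;
  move=> g [/e Ig hg]; apply: mem_degree_part.
Qed.

(** * Products with the maximal ideal, degree by degree *)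

Section MaximalIdealProduct.
Variables (K : fieldType) (n : nat).
Local Notation R := {mpoly K[n]}.
Local Notation m := (@maximal_ideal K n).
Implicit Types (I : R -> Prop).

Lemma homog1_maximal_ideal d (f : R) : f \is d.+1.-homog -> m f.
Proof.
move=> /dhomogS [g _ ->]; apply: ideal_sum => [|i]; first exact: is_ideal_gen.
by rewrite mulrC; case: (is_ideal_gen (fun f => exists i : 'I_n, f = 'X_i :> R)) => _ _;
  apply; apply: mem_ideal_gen; exists i.
Qed.

(** The degree [d.+1] component of ['X_j * h] is ['X_j] times the degree [d] component of [h].
    Together with [degree_part_maximal_mul] this turns m-fullness into colon conditions on the
    ideals [I_<d>]. *)
Lemma maximal_mul_comp I f d : is_graded_ideal I ->
  ideal_mul m I f -> ideal_degree_part I d (hcomp d.+1 f).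
Proof.
move=> [iI gI] [k [c [g [hg ->]]]]; have [I0 ID IM] := iI.
have [D0 DD DM] := is_ideal_degree_part I d.
rewrite linear_sum; apply: ideal_sum => [|i /=]; first exact: is_ideal_degree_part.
have [a [b [ma Ib ->]]] := hg i; rewrite mulrCA.
have := IM (c i) b Ib; move: (c i * b) => h Ih.
apply: (ideal_gen_min (J := fun a => forall h, I h -> ideal_degree_part I d (hcomp d.+1 (a * h)))
  _ _ ma) => // {a ma h Ih}.
  split=> [h _|a1 a2 h1 h2 h Ih|a1 a2 h2 h Ih]; first by rewrite mul0r linear0.
    by rewrite mulrDl linearD; apply: DD; [apply: h1|apply: h2].
  by rewrite -mulrA mulrCA; apply: h2; apply: IM.
move=> _ [j ->] h Ih; rewrite mulrC -addn1 hcompM ?dhomogXi // mulrC; apply: DM.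
by apply: mem_degree_part; [apply: gI | apply: pihomogP].
Qed.

(** One degree above the generators, the coefficients are linear forms. *)
Lemma degree_part_maximal_mul I f d :
  ideal_degree_part I d f -> f \is d.+1.-homog -> ideal_mul m I f.
Proof.
move=> hf /pihomog_dE <-; have [h0 _ _] := is_ideal_gen (fun f => exists g h : R, [/\ m g, I h & f = g * h]).
case: (degree_part_rep 1 hf) => [->|[k [c [g [hc hg ->]]]]] //.
apply: ideal_sum => [|i]; first exact: is_ideal_gen.
apply: mem_ideal_gen; exists (c i), (g i); split=> //; last by case: (hg i).
exact: homog1_maximal_ideal (hc i).
Qed.

Lemma mem_colon_maximal_mul I z f : z \is 1.-homog -> I f -> ideal_colon (ideal_mul m I) z f.
Proof.
move=> hz If; apply: mem_ideal_gen; exists z, f; split=> //.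
exact: homog1_maximal_ideal hz.
Qed.
End MaximalIdealProduct.

Lemma ideal_image_add (K : fieldType) n (z : {mpoly K[n.+1]})
    (phi : {lrmorphism {mpoly K[n.+1]} -> {mpoly K[n]}}) I :
  is_quotient_by z phi -> is_ideal I ->
  ideal_eq (ideal_image phi (ideal_add I (principal_ideal z))) (ideal_image phi I).
Proof.
move=> [_ _ ker] [I0 _ _] f; split=> [[_ [g [h [Ig /ker h0 ->]]] <-]|[g Ig <-]].
  by exists g; rewrite // rmorphD /= h0 addr0.
exists g => //; exists g, 0; rewrite addr0; split=> //.
by apply/ker; rewrite rmorph0.
Qed.

Lemma linres_row_ext (K : fieldType) n d (I J : {mpoly K[n]} -> Prop) :
  ideal_eq I J -> linres d (row_ideal I) -> linres d (row_ideal J).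
Proof. by move=> e; apply: linres_ext => v; apply: e. Qed.

Definition all_linres (K : fieldType) n (I : {mpoly K[n]} -> Prop) :=
  forall d, linres d (row_ideal (ideal_degree_part I d)).

Lemma linear_form_neq0 (K : fieldType) n :
  exists a : 'I_n.+1 -> K, linear_form a <> 0.
Proof.
exists (fun=> 1) => /(congr1 (mcoeff U_(ord0))); rewrite linear_form_coef mcoeff0 => /eqP.
by rewrite oner_eq0.
Qed.

Lemma is_ideal0 (K : fieldType) n : is_ideal (fun f : {mpoly K[n]} => f = 0).
Proof.
by split=> [//|f g -> ->|f g ->]; rewrite ?addr0 ?mulr0.
Qed.

Lemma generic_neq0 (K : fieldType) n :
  generic (fun a : 'I_n.+1 -> K => linear_form a <> 0).
Proof. by have [a na] := linear_form_neq0 K n; apply: generic_notin (@is_ideal0 K n.+1) na. Qed.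

(** One nonzero form from the given open set suffices: the image is linear by induction on the
    number of variables, and [linres_of_quotient] ascends from it. *)
Lemma m_full_linres (K : fieldType) (hK : infinite_field K) n (I : {mpoly K[n]} -> Prop) :
  is_graded_ideal I -> completely_m_full_rec I -> all_linres I.
Proof.
elim: n I => [|n IH] I gI.
  move=> I0 d; apply: linres_zero => v; split=> [|->]; last first.
    by rewrite /row_ideal mxE; case: (is_ideal_degree_part I d).
  move=> /(degree_part_sub gI.1) /I0 v0; apply/matrixP => i j.
  by rewrite !ord1 mxE.
move=> [U [oU neU hU]] d.
have [a [Ua /eqP z0]] := (generic_and hK (conj oU neU) (generic_neq0 K n)).2.
have hz := linear_form_homog a.
have [colon [phi [hphi rec]]] := hU a Ua.
have eI := ideal_image_add hphi gI.1.
have gI' : is_graded_ideal (ideal_image phi (ideal_add I (principal_ideal (linear_form a)))).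
  apply: graded_ideal_ext (graded_ideal_image hphi gI) => f.
  by split=> /eI.
apply: (linres_of_quotient hphi hz z0).
- exact/graded_row_ideal/graded_degree_part.
- exact: generated_row_degree_part.
(* A degree [d] form [f] with [z * f] in [I_<d>] has [z * f] in the product with the maximal ideal,
   and m-fullness puts [f] in [I]. *)
- move=> v hv; rewrite /row_ideal mxE => h; apply: mem_degree_part => //.
  apply/colon; apply: degree_part_maximal_mul h _.
  by rewrite -[d.+1]add1n; apply: dhomogM.
- apply: linres_ext (IH _ gI' rec d) => v; rewrite (mimage_row_ideal phi).
  rewrite /row_ideal (ideal_image_degree_part hphi d gI).
  exact: degree_part_ext eI (v 0 0).
- exact: linres_ext (@irrelP K n) (linres_unit_degree_part K n 1).
Qed.

Lemma ideal_unit_of_const (K : fieldType) n (I : {mpoly K[n]} -> Prop) f :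
  is_ideal I -> I f -> f \is 0.-homog -> f != 0 -> I 1.
Proof.
move=> [_ _ IM] If /dhomog0E fE f0; rewrite fE mpolyC_eq0 in f0.
have -> : 1 = ((f@_0)^-1)%:MP * f.
  by rewrite [X in _ * X]fE -mpolyCM mulVf // mpolyC1.
exact: IM.
Qed.

(** By [linres_socle], each step of the saturation can be undone in degrees at least [d]. *)
Lemma linres_saturation (K : fieldType) n d e (J : {mpoly K[n.+1]} -> Prop) f :
  is_graded_ideal J -> linres d (row_ideal J) -> (d <= e)%N -> f \is e.-homog ->
  in_saturation J f -> J f.
Proof.
move=> gJ lJ de hf sf; elim: sf e de hf => {f} [//|f _ IH] e de hf.
suff : row_ideal J f%:M by rewrite /row_ideal mxE.
apply: (linres_socle lJ de) => //; first exact: mhomog_scalar.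
move=> _ /dhomogS [g _ ->]; rewrite /row_ideal !mxE mulr_suml.
apply: ideal_sum gJ.1 _ => i; rewrite mulrAC mulrC; have [[_ _ JM] _] := gJ; apply: JM.
rewrite mulr1n; apply: (IH i e.+1); first exact: leqW.
by rewrite -[e.+1]add1n; apply: dhomogM => //; apply: dhomogXi.
Qed.

(** The colon condition must hold for all ideals [I_<d>] at once; the bound [D] on generator degrees
    reduces this to finitely many open conditions. *)
Lemma linres_m_full (K : fieldType) (hK : infinite_field K) n (I : {mpoly K[n]} -> Prop) :
  is_graded_ideal I -> ~ I 1 -> all_linres I -> completely_m_full_rec I.
Proof.
elim: n I => [|n IH] I gI nI lI.
  move=> f; split=> [If|->]; last by case: gI => [[]].
  apply/eqP/negP => /negP f0; apply: nI; apply: (ideal_unit_of_const gI.1 If) => //.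
  exact: nvar0_homog.
have [iI gIc] := gI.
have [D hD] := generated_in_bounded_degree gI.
have filt d := generic_filter_regular hK (is_ideal_degree_part I d).
pose V d := sval (constructive_indefinite_description _ (filt d)).
have hV d : generic (V d) /\ forall a f, V d a ->
    ideal_degree_part I d (linear_form a * f) -> in_saturation (ideal_degree_part I d) f.
  by rewrite /V; case: constructive_indefinite_description.
have [oU neU] := generic_and hK (generic_neq0 K n) (generic_all hK D.+1 (fun d => (hV d).1)).
exists (fun a => linear_form a <> 0 /\ forall d, (d < D.+1)%N -> V d a).
split=> // a [/eqP z0 Va]; have hz := linear_form_homog a.
set z := linear_form a in z0 hz *.
have colon d e f : (d <= e)%N -> f \is e.-homog -> ideal_degree_part I d (z * f) ->
    ideal_degree_part I d f.
  move=> de hf hzf; have zfh : z * f \is e.+1.-homog by rewrite -[e.+1]add1n; apply: dhomogM.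
  have small k : (k <= D)%N -> (k <= e)%N -> ideal_degree_part I k (z * f) ->
      ideal_degree_part I k f.
    move=> kD ke hk; apply: linres_saturation (lI k) ke hf _; first exact: graded_degree_part.
    by apply: (hV k).2 hk; apply: Va; rewrite ltnS.
  have [dD|Dd] := leqP d D; first exact: small.
  (* Past [D], the form [z * f] already lies in [I_<D>], so [f] does too; its membership is then
     moved up to [I_<d>]. *)
  have De : (D <= e)%N by apply: leq_trans de; apply: ltnW.
  have fD : ideal_degree_part I D f.
    apply: small => //; apply: (hD e.+1) => //; first exact: leqW.
    exact: degree_part_sub hzf.
  by apply: (degree_part_le iI fD hf); rewrite (ltnW Dd).
split.
  move=> f; split=> [|If]; last exact: mem_colon_maximal_mul.
  rewrite /ideal_colon => h; apply: ideal_comps => // e.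
  apply: (degree_part_sub (d := e)) => //.
  apply: (colon e e) => //; first exact: pihomogP.
  rewrite mulrC -(hcompM _ _ hz) mulrC addn1.
  exact: maximal_mul_comp.
have [phi hphi] := exists_quotient hz z0; exists phi; split=> //.
have eI := ideal_image_add hphi iI.
apply: IH.
- by apply: graded_ideal_ext (graded_ideal_image hphi gI) => f; split=> /eI.
(* The image stays proper: if [f] maps to 1, so does its degree 0 component, a nonzero constant in
   [I]. *)
- move=> /eI [f If f1]; apply: nI.
  apply: (ideal_unit_of_const iI (gIc f 0%N If) (pihomogP _ _ _)).
  apply/eqP => f0; have := quotient_hcomp hphi 0 f; rewrite f0 f1 rmorph0 pihomog_dE ?dhomog1 //.
  by move=> /esym/eqP; rewrite oner_eq0.
- move=> d; apply: linres_ext (linres_quotient hphi hz z0 (lI d) _) => [v|e v de hv].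
    rewrite (mimage_row_ideal phi) /row_ideal (ideal_image_degree_part hphi d gI).
    by apply: degree_part_ext => f; split=> /eI.
  by rewrite /row_ideal mxE; exact: (colon d e _ de (hv 0 0)).
Qed.

Theorem theorem1p1 (K : fieldType) (hK : infinite_field K) (n : nat)
    (I : {mpoly K[n]} -> Prop) (hI : is_graded_ideal I) :
  completely_m_full I <-> componentwise_linear I.
Proof.
have -> : componentwise_linear I <-> all_linres I.
  by split=> h d; apply/linear_resolutionP.
split=> [[I1|rec] d|lI].
- apply: linres_row_ext (linres_unit_degree_part K n d); apply: degree_part_ext => f.
  by split=> // _; have [[_ _ IM] _] := hI; rewrite -[f]mulr1; apply: IM.
- exact: m_full_linres.
- by case: (classic (I 1)) => nI; [left | right; apply: linres_m_full].
Qed.
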